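(* Assume that $H$ is coercive, i.e. $\lim_{|p|\to\infty}\min_{x\in\mathbb T^n}H_i(x,p)=\infty$ for every $i\in\mathbb I$, and that $B$ is a constant (independent of $x\in\mathbb T^n$) monotone matrix. Let $(c,v_0)\in\mathbb R^m\times C(\mathbb T^n)^m$ be a solution of the ergodic problem, i.e. $v_0$ is a solution of $Bv_0+H[v_0]=c$ in $\mathbb T^n$, and for $\lambda>0$ let $v^\lambda$ be the unique solution of $\lambda v^\lambda+Bv^\lambda+H[v^\lambda]=0$ in $\mathbb T^n$. Then there exists a function $v^0\in C(\mathbb T^n)^m$ such that the functions $v^\lambda+(\lambda I+B)^{-1}c$ converge to $v^0$ uniformly on $\mathbb T^n$ as $\lambda\to0+$. Moreover, the pair $(c,v^0)$ is a solution of the ergodic problem, i.e. $v^0$ is a solution of $Bv^0+H[v^0]=c$ in $\mathbb T^n$.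
   Context: Let $m,n\in\mathbb N$, $\mathbb I=\{1,\dots,m\}$, let $\mathbb T^n$ be the $n$-dimensional flat torus, $\Xi$ a (nonempty) compact metric space, $g=(g_i)_{i\in\mathbb I}\in C(\mathbb T^n\times\Xi,\mathbb R^n)^m$ and $L=(L_i)_{i\in\mathbb I}\in C(\mathbb T^n\times\Xi)^m$. The Hamiltonian $H=(H_i)_{i\in\mathbb I}$ is given by $H_i(x,p)=\max_{\xi\in\Xi}[-g_i(x,\xi)\cdot p-L_i(x,\xi)]$ for $(x,p)\in\mathbb T^n\times\mathbb R^n$. Here $B=(b_{ij})_{i,j\in\mathbb I}$ is a real $m\times m$ matrix acting by $(Bu)_i(x)=\sum_{j\in\mathbb I}b_{ij}u_j(x)$. $H[u]$ stands for $(H_i(x,Du_i(x)))_{i\in\mathbb I}$; $I$ is the identity matrix. Monotone matrix: a real $m\times m$ matrix $A$ is monotone if whenever $u\in\mathbb R^m$ and $u_k=\max_{i\in\mathbb I}u_i\ge0$, then $(Au)_k\ge0$. For monotone $B$ and $\lambda>0$, the matrix $\lambda I+B$ is invertible. Solutions are viscosity solutions: for $\lambda\ge0$ and $c\in\mathbb R^m$, $u\in C(\mathbb T^n)^m$ is a subsolution (resp. supersolution) of $\lambda u+Bu+H[u]=c$ in $\mathbb T^n$ if for every $i\in\mathbb I$, $\psi\in C^1(\mathbb T^n)$ and every maximum (resp. minimum) point $x$ of $u_i-\psi$, one has $\lambda u_i(x)+(Bu)_i(x)+H_i(x,D\psi(x))\le c_i$ (resp. $\ge c_i$); a solution is both.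 It is known that under coercivity of $H$ and monotonicity of $B$, for each $\lambda>0$ the system with $c=0$ has a unique solution $v^\lambda$, which is Lipschitz. *)

(* Defs.v *)
From mathcomp Require Import all_boot all_order all_algebra.
From mathcomp Require Import all_classical all_reals all_analysis.

Set Implicit Arguments.
Unset Strict Implicit.
Unset Printing Implicit Defensive.

Import Order.TTheory GRing.Theory Num.Theory.
Import numFieldNormedType.Exports.

Local Open Scope classical_set_scope.
Local Open Scope ring_scope.

(* Functions on the flat torus R^n / Z^n are represented by their lifts:
   Z^n-periodic functions on R^n.  An element of C(T^n)^m is a continuous
   Z^n-periodic map from R^n to the column vectors of size m. *)

Definition zperiodic (R : realType) (n : nat) (T : Type)
    (f : 'rV[R]_n -> T) : Prop :=
  forall (z : 'rV[int]_n) (x : 'rV[R]_n), f (x + map_mx intr z) = f x.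

Definition C_torus (R : realType) (n : nat) (T : topologicalType)
    (f : 'rV[R]_n -> T) : Prop :=
  continuous f /\ zperiodic f.

Definition C_torus_prod (R : realType) (n : nat) (X T : topologicalType)
    (f : 'rV[R]_n * X -> T) : Prop :=
  continuous f /\ forall xi, zperiodic (fun x => f (x, xi)).

Definition dot (R : realType) (n : nat) (p q : 'rV[R]_n) : R :=
  \sum_k p ord0 k * q ord0 k.

(* The library's norm on 'rV_n is the sup norm. *)
Definition enorm (R : realType) (n : nat) (p : 'rV[R]_n) : R :=
  Num.sqrt (dot p p).

Definition grad (R : realType) (n : nat) (psi : 'rV[R]_n -> R)
    (x : 'rV[R]_n) : 'rV[R]_n :=
  \row_k 'D_(delta_mx ord0 k) psi x.

Definition C1_torus (R : realType) (n : nat) (psi : 'rV[R]_n -> R) : Prop :=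
  [/\ zperiodic psi,
      forall x, differentiable psi x
    & continuous (grad psi)].

(* The supremum is a maximum when Xi is compact and nonempty and g, L are
   continuous. *)
Definition hamiltonian (R : realType) (m n : nat) (Xi : Type)
    (g : 'I_m -> 'rV[R]_n * Xi -> 'rV[R]_n) (L : 'I_m -> 'rV[R]_n * Xi -> R)
    (i : 'I_m) (x p : 'rV[R]_n) : R :=
  sup [set - dot (g i (x, xi)) p - L i (x, xi) | xi in [set: Xi]].

(* For H continuous and periodic in x, the infimum is a minimum. *)
Definition coercive (R : realType) (m n : nat)
    (H : 'I_m -> 'rV[R]_n -> 'rV[R]_n -> R) : Prop :=
  forall i (M : R), exists r : R, forall p : 'rV[R]_n,
    r < enorm p -> M < inf [set H i x p | x in [set: 'rV[R]_n]].

Definition monotone_mx (R : realType) (m : nat) (A : 'M[R]_m) : Prop :=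
  forall (u : 'cV[R]_m) (k : 'I_m),
    (forall i, u i ord0 <= u k ord0) -> 0 <= u k ord0 ->
    0 <= (A *m u) k ord0.

Definition viscosity_subsolution (R : realType) (m n : nat) (la : R)
    (B : 'M[R]_m) (H : 'I_m -> 'rV[R]_n -> 'rV[R]_n -> R) (c : 'cV[R]_m)
    (u : 'rV[R]_n -> 'cV[R]_m) : Prop :=
  C_torus u /\
  forall (i : 'I_m) (psi : 'rV[R]_n -> R) (x : 'rV[R]_n),
    C1_torus psi ->
    (forall y, u y i ord0 - psi y <= u x i ord0 - psi x) ->
    la * u x i ord0 + (B *m u x) i ord0 + H i x (grad psi x) <= c i ord0.

Definition viscosity_supersolution (R : realType) (m n : nat) (la : R)
    (B : 'M[R]_m) (H : 'I_m -> 'rV[R]_n -> 'rV[R]_n -> R) (c : 'cV[R]_m)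
    (u : 'rV[R]_n -> 'cV[R]_m) : Prop :=
  C_torus u /\
  forall (i : 'I_m) (psi : 'rV[R]_n -> R) (x : 'rV[R]_n),
    C1_torus psi ->
    (forall y, u x i ord0 - psi x <= u y i ord0 - psi y) ->
    c i ord0 <= la * u x i ord0 + (B *m u x) i ord0 + H i x (grad psi x).

Definition viscosity_solution (R : realType) (m n : nat) (la : R)
    (B : 'M[R]_m) (H : 'I_m -> 'rV[R]_n -> 'rV[R]_n -> R) (c : 'cV[R]_m)
    (u : 'rV[R]_n -> 'cV[R]_m) : Prop :=
  viscosity_subsolution la B H c u /\ viscosity_supersolution la B H c u.

Definition ergodic_solution (R : realType) (m n : nat)
    (B : 'M[R]_m) (H : 'I_m -> 'rV[R]_n -> 'rV[R]_n -> R) (c : 'cV[R]_m)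
    (u : 'rV[R]_n -> 'cV[R]_m) : Prop :=
  viscosity_solution 0 B H c u.

(* Main.v *)
Require Import Defs.
From HB Require Import structures.
From mathcomp Require Import all_boot all_order all_algebra.
From mathcomp Require Import all_classical all_reals all_analysis.
From mathcomp Require Import ring lra.

Set Implicit Arguments.
Unset Strict Implicit.
Unset Printing Implicit Defensive.

Import Order.TTheory GRing.Theory Num.Theory.
Import numFieldNormedType.Exports.

Local Open Scope classical_set_scope.
Local Open Scope ring_scope.

(** Adding a constant vector to a function does not change its gradient, so
[u la := v la + invmx (la%:M + B) *m c] solves [la u + B u + H[u] = c], with the same
right-hand side as the ergodic problem. Comparison with [v0 + C] and [v0 - C], where
[C] bounds [v0], gives [`|u la| <= 2 C] (lemma [discounted_bound]). Then the equation
bounds [H] along test gradients, coercivity bounds these gradients, and the family is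
equi-Lipschitz for [0 < la <= 1] (lemma [discounted_equilipschitz]). Hence it has
uniform cluster points as [la] tends to 0 (lemma [equilipschitz_cluster]), and by
stability of viscosity solutions each of them solves the ergodic problem (lemma
[ergodic_of_cluster]). It remains to see that there is only one cluster point.

The reason is a monotonicity in the discount (lemma [critical_gap_monotone]): if [z]
is a subsolution of the ergodic problem, then [max (0, max (z - u la))] does not
increase as [la] decreases to 0. Indeed, for [nu < la] and [a = nu / la], convexity
of [H] makes [a u la + (1 - a) z], lowered by a constant, a subsolution of the problem
with discount [nu], which comparison places below [u nu]. When [z] is itself a cluster
point, this gap tends to 0 along some sequence, hence along the whole family, so that
[z] is at most the lower limit of [u la] (lemma [cluster_is_lower_limit]). Two cluster
points are therefore each below the other. The usual way to identify the limit, by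
means of Mather measures, is thereby avoided.

Comparison and monotonicity are both instances of [convex_combination_touching], a
doubling of variables with one variable for each of two subsolutions and one for the
supersolution. All test functions are built from [tdist2 x], the sum of the squares of
[sin (pi x_k)], a smooth periodic substitute for the squared Euclidean norm. *)

(** * Gradients and periodic C1 test functions *)

Section Gradient.
Context {R : realType} {n : nat}.
Implicit Types (f psi : 'rV[R]_n -> R) (x y z : 'rV[R]_n).

Lemma derive_comp_real f (h : R -> R) x v (dh : R) :
  differentiable f x -> is_derive (f x) 1 h dh ->
  differentiable (h \o f) x /\ 'D_v (h \o f) x = dh * 'D_v f x.
Proof.
move=> df hd.
have dfh : differentiable h (f x).
  by apply/derivable1_diffP; apply: ex_derive.
have dc : differentiable (h \o f) x by apply: differentiable_comp.
split=> //; rewrite !deriveE// diff_comp//= diff1E; last exact: dfh.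
by rewrite derive1E derive_val mulrC.
Qed.

Lemma derive_coord x v k :
  differentiable (fun y : 'rV[R]_n => y ord0 k) x /\
  'D_v (fun y : 'rV[R]_n => y ord0 k) x = v ord0 k.
Proof.
have d : differentiable (fun y : 'rV[R]_n => y ord0 k) x.
  exact: differentiable_coord.
split=> //; rewrite deriveE//.
have lin : linear (fun y : 'rV[R]_n => (y ord0 k : R)).
  by move=> a u w; rewrite !mxE.
pose aux := GRing.isLinear.Build _ _ _ _ _ lin.
pose L : {linear 'rV[R]_n -> R} := HB.pack (fun y : 'rV[R]_n => y ord0 k) aux.
rewrite (_ : (fun y : 'rV[R]_n => y ord0 k) = L)// diff_lin//.
exact: coord_continuous.
Qed.

Lemma gradD f g x : differentiable f x -> differentiable g x ->
  grad (f \+ g) x = grad f x + grad g x.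
Proof.
move=> df dg; apply/rowP => k; rewrite !mxE deriveD//; exact: diff_derivable.
Qed.

Lemma gradZ (a : R) f x : differentiable f x ->
  grad (fun y => a * f y) x = a *: grad f x.
Proof.
move=> df; apply/rowP => k; rewrite !mxE deriveZ//; exact: diff_derivable.
Qed.

Lemma grad_zperiodic f : zperiodic f -> zperiodic (grad f).
Proof.
move=> pf z x; apply/rowP => k; rewrite !mxE /derive.
by under eq_fun do rewrite /= addrA !pf.
Qed.

Lemma C1_torus_cont psi : C1_torus psi -> C_torus psi.
Proof. by case=> p d _; split=> // x; apply: differentiable_continuous. Qed.

Lemma C1_torus_grad psi : C1_torus psi -> C_torus (grad psi).
Proof. by case=> p d c; split=> //; apply: grad_zperiodic. Qed.

Lemma C1_torus_cst (a : R) : C1_torus (fun _ : 'rV[R]_n => a).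
Proof.
split=> //.
rewrite (_ : grad _ = (fun=> 0)); first by move=> x; exact: cst_continuous.
by apply/funext => x; apply/rowP => k; rewrite !mxE derive_cst.
Qed.

Lemma C1_torusD f g : C1_torus f -> C1_torus g -> C1_torus (f \+ g).
Proof.
move=> [pf df cf] [pg dg cg]; split.
- by move=> z x /=; rewrite pf pg.
- by move=> x; apply: differentiableD.
- rewrite (_ : grad _ = grad f \+ grad g); last first.
    by apply/funext => x; rewrite gradD.
  by move=> x; apply: continuousD; [exact: cf|exact: cg].
Qed.

Lemma C1_torusZ (a : R) f : C1_torus f -> C1_torus (fun y => a * f y).
Proof.
move=> [pf df cf]; split.
- by move=> z x /=; rewrite pf.
- by move=> x; apply: differentiableZ.
- rewrite (_ : grad _ = (fun x => a *: grad f x)); last first.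
    by apply/funext => x; rewrite gradZ.
  by move=> x; apply: continuousZl_tmp; exact: cf.
Qed.

Lemma grad_sqrt f x : differentiable f x -> 0 < f x ->
  differentiable (fun y => Num.sqrt (f y)) x /\
  grad (fun y => Num.sqrt (f y)) x = (2 * Num.sqrt (f x))^-1 *: grad f x.
Proof.
move=> df f0.
have H v := derive_comp_real v df (is_derive1_sqrt f0).
split; first by have [] := H 0.
by apply/rowP => k; rewrite !mxE; have [_ <-] := H (delta_mx ord0 k).
Qed.

Lemma C1_torus_sqrt f : C1_torus f -> (forall x, 0 < f x) ->
  C1_torus (fun y => Num.sqrt (f y)).
Proof.
move=> [pf df cf] f0; split.
- by move=> z x /=; rewrite pf.
- by move=> x; have [] := grad_sqrt (df x) (f0 x).
- rewrite (_ : grad _ =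
    (fun x => (2 * Num.sqrt (f x))^-1 *: grad f x)); last first.
    by apply/funext => x; have [_ ->] := grad_sqrt (df x) (f0 x).
  move=> x.
  apply: (@continuousZ R _ _ (fun y => (2 * Num.sqrt (f y))^-1) (grad f));
    last exact: cf.
  apply: (@continuousV R _ (fun y => 2 * Num.sqrt (f y))).
    by rewrite mulf_neq0// gt_eqF// sqrtr_gt0.
  apply: (@continuousM R _ (cst 2)); first exact: cst_continuous.
  apply: (@continuous_comp _ _ _ f).
    exact: differentiable_continuous.
  exact: sqrt_continuous.
Qed.

End Gradient.

Lemma continuous_mx {R : realType} (T : topologicalType) p q
    (f : T -> 'M[R]_(p, q)) :
  (forall i j, continuous (fun t => f t i j)) -> continuous f.
Proof.
move=> cf t; apply/cvgrPdist_lt => e e0.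
near=> y; rewrite [ltLHS](_ : _ = mx_norm (f t - f y))// mx_normrE.
apply/bigmax_ltP; split=> //= ij _ /=.
rewrite !mxE; move: ij; near: y.
apply: filter_forall => ij.
by have /cvgrPdist_lt /(_ e e0) := cf ij.1 ij.2 t; apply.
Unshelve. all: by end_near. Qed.

(** * A smooth squared distance on the torus *)

Section Gauge.
Context {R : realType} {n : nat}.
Implicit Types (x y z : 'rV[R]_n).

(** On the torus this function replaces the squared Euclidean norm: it is smooth and
periodic, and vanishes exactly on the integer lattice. *)
Definition tdist2 x : R := \sum_k sin (pi * x ord0 k) ^+ 2.

(** The gradient of [tdist2]. *)
Definition dtdist2 x : 'rV[R]_n :=
  \row_k (2 * pi * sin (pi * x ord0 k) * cos (pi * x ord0 k)).

Lemma sin2_pi_intr (a : R) (j : int) :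
  sin (pi * (a + j%:~R)) ^+ 2 = sin (pi * a) ^+ 2.
Proof.
have nat_case (b : R) (k : nat) : sin (pi * (b + k%:R)) ^+ 2 = sin (pi * b) ^+ 2.
  elim: k => [|k IH]; first by rewrite addr0.
  by rewrite -natr1 addrA mulrDr mulr1 sinDpi sqrrN.
case: j => k; first exact: nat_case.
by rewrite NegzE -(nat_case (a + _) k.+1) mulrNz subrK.
Qed.

Lemma tdist2_periodic : zperiodic tdist2.
Proof.
by move=> z x; apply: eq_bigr => k _; rewrite !mxE sin2_pi_intr.
Qed.

Lemma tdist2_ge0 x : 0 <= tdist2 x.
Proof. by apply: sumr_ge0 => k _; exact: sqr_ge0. Qed.

Lemma tdist20 : tdist2 0 = 0.
Proof. by apply: big1 => k _; rewrite mxE mulr0 sin0 expr0n. Qed.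

Lemma tdist2N x : tdist2 (- x) = tdist2 x.
Proof. by apply: eq_bigr => k _; rewrite mxE mulrN sinN sqrrN. Qed.

Lemma tdist2C x y : tdist2 (x - y) = tdist2 (y - x).
Proof. by rewrite -tdist2N opprB. Qed.

Lemma dtdist2N x : dtdist2 (- x) = - dtdist2 x.
Proof. by apply/rowP => k; rewrite !mxE mulrN sinN cosN mulrN mulNr. Qed.

Lemma dtdist20 : dtdist2 0 = 0.
Proof. by apply/rowP => k; rewrite !mxE mulr0 sin0 mulr0 mul0r. Qed.

(** The sine has no zero in (0, pi), so every coordinate has fractional part 0. *)
Lemma tdist2_eq0 x : tdist2 x = 0 -> exists z : 'rV[int]_n, x = map_mx intr z.
Proof.
move=> x0; exists (\row_k Num.floor (x ord0 k)); apply/rowP => k; rewrite !mxE.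
have : sin (pi * x ord0 k) ^+ 2 = 0.
  by apply: (psumr_eq0P _ x0) => // j _; exact: sqr_ge0.
set a := x ord0 k; rewrite -(subrK (Num.floor a)%:~R a) sin2_pi_intr subrK.
move/eqP; rewrite sqrf_eq0 => /eqP s0.
apply/eqP; rewrite -subr_eq0 eq_le subr_ge0 floor_le_tmp andbT leNgt.
apply/negP => f0.
suff : 0 < sin (pi * (a - (Num.floor a)%:~R)) by rewrite s0 ltxx.
apply: sin_gt0_pi; rewrite mulr_gt0 ?pi_gt0//= -[ltRHS]mulr1.
rewrite ltr_pM2l ?pi_gt0// ltrBlDl -intrD1.
exact: floorD1_gt.
Qed.

Lemma sin2_le_tdist2 x k : sin (pi * x ord0 k) ^+ 2 <= tdist2 x.
Proof.
by rewrite /tdist2 (bigD1 k)//= lerDl; apply: sumr_ge0 => j _; exact: sqr_ge0.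
Qed.

(** A periodic function has critical points away from its minimum, here at half
integers, so the gradient controls the distance only near the lattice:
[tdist2 x <= 1/2] forces every squared cosine in the gradient to be at least 1/2. *)
Lemma dot_dtdist2 x : tdist2 x <= 2^-1 ->
  2 * pi ^+ 2 * tdist2 x <= dot (dtdist2 x) (dtdist2 x).
Proof.
move=> x2; rewrite /dot /tdist2 mulr_sumr; apply: ler_sum => k _; rewrite !mxE.
have := le_trans (sin2_le_tdist2 x k) x2.
move: (cos2sin2 (pi * x ord0 k)) (sqr_ge0 (sin (pi * x ord0 k))).
set s := sin _; set c := cos _ => c2 s0 s2.
rewrite (_ : _ * _ * _ * _ = 4 * pi ^+ 2 * s ^+ 2 * c ^+ 2); last by ring.
have -> : 2 * pi ^+ 2 * s ^+ 2 = 4 * pi ^+ 2 * s ^+ 2 * 2^-1 by field.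
apply: ler_wpM2l; last by rewrite c2; lra.
by rewrite mulr_ge0// mulr_ge0// sqr_ge0.
Qed.

Lemma tdist2_translate z x :
  differentiable (fun y => tdist2 (y - z)) x /\
  grad (fun y => tdist2 (y - z)) x = dtdist2 (x - z).
Proof.
pose h (k : 'I_n) (t : R) := sin (pi * (t - z ord0 k)) ^+ 2.
have hd k : is_derive (x ord0 k) 1 (h k)
    (2 * pi * sin (pi * (x - z) ord0 k) * cos (pi * (x - z) ord0 k)).
  rewrite /h; apply: is_derive_eq.
  rewrite !mxE /GRing.scale/=; ring.
pose coord (k : 'I_n) := fun y : 'rV[R]_n => y ord0 k.
have Hk k v := derive_comp_real v (derive_coord x v k).1 (hd k).
have E : (fun y => tdist2 (y - z)) = \sum_k (h k \o coord k).
  apply/funext => y; rewrite fct_sumE /tdist2; apply: eq_bigr => k _.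
  by rewrite /h /coord /= !mxE.
have dk k : differentiable (h k \o coord k) x by have [] := Hk k 0.
rewrite E; split; first exact: differentiable_sum.
apply/rowP => j; rewrite !mxE derive_sum; last by move=> k; exact: diff_derivable.
rewrite (bigD1 j)//= big1 => [|k kj]; last first.
  have [_ ->] := Hk k (delta_mx ord0 j).
  have [_ ->] := derive_coord x (delta_mx ord0 j) k.
  by rewrite [delta_mx _ _ _ _]mxE (negbTE kj) andbF mulr0.
have [_ ->] := Hk j (delta_mx ord0 j).
have [_ ->] := derive_coord x (delta_mx ord0 j) j.
by rewrite addr0 !mxE !eqxx mulr1.
Qed.

Lemma C1_tdist2 z : C1_torus (fun y => tdist2 (y - z)).
Proof.
split.
- by move=> j x; rewrite addrAC tdist2_periodic.
- by move=> x; have [] := tdist2_translate z x.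
- rewrite (_ : grad _ = (fun x => dtdist2 (x - z))); last first.
    by apply/funext => x; have [] := tdist2_translate z x.
  apply: continuous_mx => i k x; rewrite {i}(ord1 i).
  under eq_fun do rewrite !mxE.
  pose l (y : 'rV[R]_n) := pi * (y ord0 k - z ord0 k).
  have lin : {for x, continuous l}.
    apply: (@continuousM R _ (cst pi) (fun y => y ord0 k - z ord0 k)).
      exact: cst_continuous.
    apply: (@continuousB _ _ _ (fun y : 'rV[R]_n => y ord0 k) (cst (z ord0 k))).
      exact: coord_continuous.
    exact: cst_continuous.
  apply: (@continuousM R _ (fun y => 2 * pi * sin (l y)) (cos \o l)).
    apply: (@continuousM R _ (cst (2 * pi)) (sin \o l)).
      exact: cst_continuous.
    by apply: (continuous_comp lin); exact: continuous_sin.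
  by apply: (continuous_comp lin); exact: continuous_cos.
Qed.

Lemma grad_tdist2 z x : grad (fun y => tdist2 (y - z)) x = dtdist2 (x - z).
Proof. exact: (tdist2_translate z x).2. Qed.

Lemma continuous_tdist2 : continuous tdist2.
Proof.
have [+ _] := C1_torus_cont (C1_tdist2 0).
by under eq_fun do rewrite subr0.
Qed.

End Gauge.

(** * Compactness of the torus *)

Section Compactness.
Context {R : realType} {n : nat}.
Implicit Types (x y z : 'rV[R]_n).

Definition cube : set 'rV[R]_n := [set x | forall k, 0 <= x ord0 k <= 1].

Lemma cube_compact : compact cube.
Proof.
have := @rV_compact R n (fun=> `[0, 1]%classic) (fun=> @segment_compact R 0 1).
congr compact; apply/seteqP; split => x /= xc k; have := xc k; rewrite /= in_itv//.
Qed.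

Lemma cube_repr x : exists z : 'rV[int]_n, cube (x + map_mx intr z).
Proof.
exists (\row_k - Num.floor (x ord0 k)) => k.
rewrite !mxE mulrNz subr_ge0 floor_le_tmp/= lerBlDl -intrD1.
exact/ltW/floorD1_gt.
Qed.

Lemma cube0 : cube 0.
Proof. by move=> k; rewrite mxE lexx ler01. Qed.

(** Uniform continuity on the torus, uniformly in a compact parameter, and with respect
to [tdist2]. Near a pair of points at positive distance the premise fails for small
[d]; near a pair at distance zero both values agree by periodicity, so continuity
applies. Compactness of pairs makes [d] uniform. *)
Lemma periodic_unif_cont (X : topologicalType) (V : normedModType R)
    (K : set X) (F : 'rV[R]_n * X -> V) :
  compact K -> C_torus_prod F -> forall eta : R, 0 < eta ->
  exists2 d : R, 0 < d & forall xi x y, K xi -> tdist2 (x - y) < d ->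
    `|F (x, xi) - F (y, xi)| < eta.
Proof.
move=> cK [cF pF] eta eta0.
have eta2 : 0 < eta / 2 by rewrite divr_gt0.
pose K3 : set (('rV[R]_n * 'rV[R]_n) * X) := (cube `*` cube) `*` K.
have cK3 : compact K3.
  by apply: compact_setX => //; apply: compact_setX; exact: cube_compact.
pose P (d : R) (t : ('rV[R]_n * 'rV[R]_n) * X) : Prop :=
  tdist2 (t.1.1 - t.1.2) < d -> `|F (t.1.1, t.2) - F (t.1.2, t.2)| < eta.
pose T3 := (('rV[R]_n * 'rV[R]_n) * X)%type.
have p1 : continuous (fun t : T3 => t.1.1).
  by move=> t; apply: (@continuous_comp _ _ _ fst fst); exact: cvg_fst.
have p2 : continuous (fun t : T3 => t.1.2).
  by move=> t; apply: (@continuous_comp _ _ _ fst snd); [exact: cvg_fst|exact: cvg_snd].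
have c1 : continuous (fun t : T3 => F (t.1.1, t.2)).
  move=> t; apply: (@continuous_comp _ _ _ (fun t : T3 => (t.1.1, t.2)) F);
    last exact: cF.
  exact: (cvg_pair (p1 t) cvg_snd).
have c2 : continuous (fun t : T3 => F (t.1.2, t.2)).
  move=> t; apply: (@continuous_comp _ _ _ (fun t : T3 => (t.1.2, t.2)) F);
    last exact: cF.
  exact: (cvg_pair (p2 t) cvg_snd).
have c3 : continuous (fun t : T3 => tdist2 (t.1.1 - t.1.2)).
  move=> t; apply: (@continuous_comp _ _ _ (fun t : T3 => t.1.1 - t.1.2) tdist2);
    last exact: continuous_tdist2.
  exact: (continuousB (p1 t) (p2 t)).
have : \forall d \near 0^'+, K3 `<=` P d.
  move/compact_near_coveringP : cK3; apply => -[[x y] xi] _ /=.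
  have [xy0|xyN0] := eqVneq (tdist2 (x - y)) 0.
    have Fxy : F (x, xi) = F (y, xi).
      have [z xyz] := tdist2_eq0 xy0.
      by rewrite -(subrK y x) xyz addrC (pF xi).
    near=> t d => _ /=.
    rewrite -(subrK (F (x, xi)) (F _)) -addrA.
    apply: (le_lt_trans (ler_normD _ _)).
    rewrite (splitr eta); apply: ltrD.
      rewrite distrC; near: t.
      by have /cvgrPdist_lt /(_ _ eta2) := c1 ((x, y), xi); apply.
    rewrite Fxy; near: t.
    by have /cvgrPdist_lt /(_ _ eta2) := c2 ((x, y), xi); apply.
  have xy0 : 0 < tdist2 (x - y) by rewrite lt_def xyN0 tdist2_ge0.
  have dhalf : 0 < tdist2 (x - y) / 2 by rewrite divr_gt0.
  have near_t : \forall t \near ((x, y), xi),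
      tdist2 (x - y) / 2 <= tdist2 (t.1.1 - t.1.2).
    by apply: (cvgr_ge _ (c3 ((x, y), xi))) => /=; lra.
  have near_d := nbhs_right_le dhalf.
  exists ([set t : T3 | tdist2 (x - y) / 2 <= tdist2 (t.1.1 - t.1.2)],
          [set d | d <= tdist2 (x - y) / 2]).
    by split; [exact: near_t | exact: near_d].
  by move=> [t d] [/= tge dle]; rewrite /P ltNge (le_trans dle tge).
move=> H; near (0:R)^'+ => d; exists d => //.
move=> xi x y Kxi.
have [z1 xc] := cube_repr x; have [z2 yc] := cube_repr y.
have Hd : K3 `<=` P d by near: d.
have := Hd ((x + map_mx intr z1, y + map_mx intr z2), xi) (conj (conj xc yc) Kxi).
rewrite /P /= !(pF xi) [x + _ - _]addrAC tdist2_periodic.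
by rewrite (tdist2C x (y + _)) [y + _ - _]addrAC tdist2_periodic (tdist2C y).
Unshelve. all: by end_near. Qed.


Lemma torus_unif_cont (V : normedModType R) (f : 'rV[R]_n -> V) :
  C_torus f -> forall eta : R, 0 < eta ->
  exists2 d : R, 0 < d & forall x y, tdist2 (x - y) < d -> `|f x - f y| < eta.
Proof.
move=> [cf pf] eta eta0.
have [|d d0 H] := @periodic_unif_cont R V [set 0] (f \o fst)
  (@compact_set1 _ _) _ _ eta0.
  split=> [t|xi z x /=]; last exact: pf.
  by apply: (@continuous_comp _ _ _ fst f); [exact: cvg_fst|exact: cf].
by exists d => // x y; exact: (H 0).
Qed.

Lemma torus_max (f : 'rV[R]_n -> R) : C_torus f ->
  exists x0, forall x, f x <= f x0.
Proof.
move=> [cf pf].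
have [||x0 _ max_x0] := compact_EVT_max (f := f) _ cube_compact.
- by exists 0; exact: cube0.
- exact: continuous_subspaceT.
exists x0 => x; have [z /mem_set xc] := cube_repr x.
by rewrite -(pf z); exact: max_x0.
Qed.

Lemma torus3_max (f : 'rV[R]_n * 'rV[R]_n * 'rV[R]_n -> R) : continuous f ->
  (forall y z, zperiodic (fun x => f (x, y, z))) ->
  (forall x z, zperiodic (fun y => f (x, y, z))) ->
  (forall x y, zperiodic (fun z => f (x, y, z))) ->
  exists t0, forall t, f t <= f t0.
Proof.
move=> cf p1 p2 p3.
have [|||t0 _ max_t0] := compact_EVT_max (f := f) (A := cube `*` cube `*` cube).
- by exists (0, 0, 0); split; [split|]; exact: cube0.
- by do 2 (apply: compact_setX; last exact: cube_compact); exact: cube_compact.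
- exact: continuous_subspaceT.
exists t0 => -[[x y] z].
have [i xi] := cube_repr x; have [j yj] := cube_repr y; have [k zk] := cube_repr z.
rewrite -(p1 _ _ i) -(p2 _ _ j) -(p3 _ _ k); apply: max_t0.
by apply/mem_set; split; [split|].
Qed.

Lemma finite_max m (F : 'I_m -> R) : 'I_m -> exists i, forall j, F j <= F i.
Proof.
move=> i0; case: (@Order.TotalTheory.arg_maxP _ _ _ i0 xpredT F isT) => i _ maxi.
by exists i => j; exact: maxi.
Qed.

End Compactness.

(** * Convex coercive Hamiltonians *)

Section FiniteChoices.
Context {R : realType} {m : nat}.

Lemma finite_large (P : 'I_m -> R -> Prop) :
  (forall i r r', r <= r' -> P i r -> P i r') ->
  (forall i, exists r, P i r) -> exists r, forall i, P i r.
Proof.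
move=> mono /choice[r Pr]; exists (\sum_i `|r i|) => i.
apply: (mono _ (r i)) => //; apply: (le_trans (ler_norm _)).
by rewrite (bigD1 i)//= lerDl sumr_ge0.
Qed.

Lemma finite_small (P : 'I_m -> R -> Prop) :
  (forall i d d', d' <= d -> P i d -> P i d') ->
  (forall i, exists2 d, 0 < d & P i d) -> exists2 d, 0 < d & forall i, P i d.
Proof.
move=> mono ex.
have /choice[d dP] : forall i, exists d, 0 < d /\ P i d.
  by move=> i; have [d] := ex i; exists d.
have inv_ge0 i : 0 <= (d i)^-1 by rewrite invr_ge0 ltW// (dP i).1.
have sum_ge0 (Q : pred 'I_m) : 0 <= \sum_(i | Q i) (d i)^-1 by exact: sumr_ge0.
have pos : 0 < 1 + \sum_i (d i)^-1 by rewrite ltr_pwDl.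
exists (1 + \sum_i (d i)^-1)^-1 => [|i]; first by rewrite invr_gt0.
apply: mono (dP i).2; rewrite invf_ple ?posrE ?(dP i).1//.
by rewrite (bigD1 i)//= addrCA lerDl addr_ge0.
Qed.

End FiniteChoices.

Section Norms.
Context {R : realType}.

Lemma coord_le_norm m n (A : 'M[R]_(m, n)) i j : `|A i j| <= `|A|.
Proof.
rewrite [leRHS](_ : _ = mx_norm A)// mx_normrE.
by apply: (le_bigmax _ (fun ij : 'I_m * 'I_n => `|A ij.1 ij.2|) (i, j)).
Qed.

Lemma norm_leP m n (A : 'M[R]_(m, n)) (e : R) : 0 <= e ->
  (forall i j, `|A i j| <= e) -> `|A| <= e.
Proof.
move=> e0 Ae; rewrite [leLHS](_ : _ = mx_norm A)// mx_normrE.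
by apply/bigmax_leP; split=> // -[i j] _ /=.
Qed.

Variable n : nat.
Implicit Types p q : 'rV[R]_n.

(** The norm of row vectors is the maximum norm, hence the factor [n]. *)
Lemma dot_le_norm p q : `|dot p q| <= n%:R * `|p| * `|q|.
Proof.
rewrite /dot; apply: (le_trans (ler_norm_sum _ _ _)).
have -> : n%:R * `|p| * `|q| = \sum_(k < n) `|p| * `|q|.
  by rewrite sumr_const card_ord -mulrA mulr_natl.
by apply: ler_sum => k _; rewrite normrM ler_pM// coord_le_norm.
Qed.

Lemma norm_le_enorm p : `|p| <= enorm p.
Proof.
apply: norm_leP => [|i k]; first exact: sqrtr_ge0.
rewrite (ord1 i) -sqrtr_sqr; apply: ler_wsqrtr.
rewrite /dot (bigD1 k)//= expr2 lerDl.
by apply: sumr_ge0 => j _; rewrite -expr2 sqr_ge0.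
Qed.

Lemma dotDr p q1 q2 : dot p (q1 + q2) = dot p q1 + dot p q2.
Proof. by rewrite -big_split; apply: eq_bigr => k _; rewrite mxE mulrDr. Qed.

Lemma dotZr (a : R) p q : dot p (a *: q) = a * dot p q.
Proof. by rewrite mulr_sumr; apply: eq_bigr => k _; rewrite mxE mulrCA. Qed.

Lemma dotBr p q1 q2 : dot p (q1 - q2) = dot p q1 - dot p q2.
Proof. by rewrite -scaleN1r dotDr dotZr mulN1r. Qed.

Lemma dotBl p1 p2 q : dot (p1 - p2) q = dot p1 q - dot p2 q.
Proof. by rewrite -sumrB; apply: eq_bigr => k _; rewrite !mxE mulrBl. Qed.

End Norms.

Lemma sup_le_addr {R : realType} (T : Type) (f1 f2 : T -> R) (e : R) :
  [set: T] !=set0 -> has_ubound (range f2) ->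
  (forall t, f1 t <= f2 t + e) -> sup (range f1) <= sup (range f2) + e.
Proof.
move=> [t0 _] ub f12; apply: ge_sup; first by exists (f1 t0), t0.
move=> _ [t _ <-]; apply: (le_trans (f12 t)); rewrite lerD2r.
by apply: ub_le_sup => //; exists t.
Qed.

Lemma torus_prod_bounded {R : realType} n (X : topologicalType)
    (V : normedModType R) (F : 'rV[R]_n * X -> V) :
  compact [set: X] -> C_torus_prod F ->
  exists2 C : R, 0 <= C & forall t, `|F t| <= C.
Proof.
move=> cX [cF pF].
have : bounded_set (F @` (cube `*` [set: X])).
  apply/compact_bounded/continuous_compact; first exact: continuous_subspaceT.
  by apply: compact_setX => //; exact: cube_compact.
move=> /ex_strict_bound_gt0[k k0 Fk]; exists k; first exact: ltW.
move=> [x xi]; have [z xc] := cube_repr x.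
by rewrite -(pF xi z); apply/ltW/Fk; exists (x + map_mx intr z, xi).
Qed.

(** The only facts about the Hamiltonian that the argument uses. The modulus of
continuity in [x] is uniform on bounded sets of momenta, and coercivity takes the
form of uniformly bounded sublevel sets. *)
Record convex_coercive (R : realType) (m n : nat)
    (H : 'I_m -> 'rV[R]_n -> 'rV[R]_n -> R) : Prop := ConvexCoercive {
  ham_convex : forall i x p q (a b : R), 0 <= a -> 0 <= b -> a + b = 1 ->
    H i x (a *: p + b *: q) <= a * H i x p + b * H i x q;
  ham_unif : forall r eta : R, 0 < eta -> exists2 d : R, 0 < d &
    forall i x y p, enorm p <= r -> tdist2 (x - y) < d ->
    `|H i x p - H i y p| <= eta;
  ham_lipschitz : exists2 G : R, 0 <= G &
    forall i x p q, `|H i x p - H i x q| <= G * `|p - q|;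
  ham_sublevel : forall M : R, exists r : R,
    forall i x p, H i x p <= M -> enorm p <= r }.

(** A supremum of affine functions of [p] is convex; its slopes are values of [g], which
is bounded, hence the Lipschitz bound; and a uniform bound on the variation of the
affine functions in [x] passes to their supremum. The infimum in the definition of
coercivity bounds [H] from below because it is taken over a set that is bounded
from below. *)
Lemma hamiltonian_convex_coercive (R : realType) (m n : nat)
    (Xi : topologicalType) (g : 'I_m -> 'rV[R]_n * Xi -> 'rV[R]_n)
    (L : 'I_m -> 'rV[R]_n * Xi -> R) :
  [set: Xi] !=set0 -> compact [set: Xi] ->
  (forall i, C_torus_prod (g i)) -> (forall i, C_torus_prod (L i)) ->
  coercive (hamiltonian g L) -> convex_coercive (hamiltonian g L).
Proof.
move=> Xi0 cXi g_cont L_cont coer.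
have [G G0 gG] : exists2 G : R, 0 <= G & forall i t, `|g i t| <= G.
  have [|i|G HG] := @finite_large R m (fun i r => forall t, `|g i t| <= r).
  - by move=> i r r' rr' gr t; exact: le_trans (gr t) rr'.
  - by have [C _ HC] := torus_prod_bounded cXi (g_cont i); exists C.
  by exists `|G| => // i t; exact: le_trans (HG i t) (ler_norm _).
have [Lb LbP] : exists C : R, forall i t, `|L i t| <= C.
  have [|i|C HC] := @finite_large R m (fun i r => forall t, `|L i t| <= r).
  - by move=> i r r' rr' gr t; exact: le_trans (gr t) rr'.
  - by have [C _ HC] := torus_prod_bounded cXi (L_cont i); exists C.
  by exists C.
have dotG i t p : `|dot (g i t) p| <= n%:R * G * `|p|.
  apply: (le_trans (dot_le_norm _ _)).
  by rewrite ler_wpM2r// ler_wpM2l.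
have ub i x p : has_ubound
    (range (fun xi => - dot (g i (x, xi)) p - L i (x, xi))).
  exists (n%:R * G * `|p| + Lb) => _ [xi _ <-].
  have := dotG i (x, xi) p; have := LbP i (x, xi); rewrite !ler_norml; lra.
have Hlip i x p q :
    hamiltonian g L i x p <= hamiltonian g L i x q + n%:R * G * `|p - q|.
  apply: sup_le_addr => // xi.
  by have := dotG i (x, xi) (p - q); rewrite ler_norml dotBr; lra.
split.
- move=> i x p q a b a0 b0 ab; apply: ge_sup.
    by case: Xi0 => xi _; eexists; exists xi.
  move=> _ [xi _ <-]; rewrite dotDr !dotZr.
  have bound w : - dot (g i (x, xi)) w - L i (x, xi) <= hamiltonian g L i x w.
    by apply: ub_le_sup => //; exists xi.
  have := ler_wpM2l a0 (bound p); have := ler_wpM2l b0 (bound q).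
  have Lab : L i (x, xi) = a * L i (x, xi) + b * L i (x, xi).
    by rewrite -mulrDl ab mul1r.
  lra.
- move=> r eta eta0.
  have eta2 : 0 < eta / 2 by rewrite divr_gt0.
  pose e := eta / 2 / (n%:R * `|r| + 1).
  have den : 0 < n%:R * `|r| + 1 by rewrite ltr_wpDl// mulr_ge0.
  have e0 : 0 < e by rewrite divr_gt0.
  have [||d d0 Hd] := @finite_small R m (fun i d =>
      forall x y xi, tdist2 (x - y) < d ->
        `|g i (x, xi) - g i (y, xi)| <= e /\
        `|L i (x, xi) - L i (y, xi)| <= eta / 2).
  + by move=> i d d' dd' HP x y xi xy; apply: HP; exact: lt_le_trans xy dd'.
  + move=> i; have [d1 d10 H1] := periodic_unif_cont cXi (g_cont i) e0.
    have [d2 d20 H2] := periodic_unif_cont cXi (L_cont i) eta2.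
    exists (Num.min d1 d2); first by rewrite lt_min d10.
    move=> x y xi; rewrite lt_min => /andP[xy1 xy2].
    by split; apply/ltW; [exact: H1|exact: H2].
  exists d => // i x y p pr.
  have half u w : tdist2 (u - w) < d ->
      hamiltonian g L i u p <= hamiltonian g L i w p + eta.
    move=> uw; apply: sup_le_addr => // xi.
    have [gd Ld] := Hd i _ _ xi uw.
    have : `|dot (g i (u, xi) - g i (w, xi)) p| <= eta / 2.
      apply: (le_trans (dot_le_norm _ _)).
      apply: (@le_trans _ _ (e * (n%:R * `|r| + 1)));
        last by rewrite divfK ?gt_eqF.
      rewrite [n%:R * _]mulrC -mulrA ler_pM//.
      apply: (@le_trans _ _ (n%:R * `|r|)); last by rewrite lerDl.
      rewrite ler_wpM2l//; apply: (le_trans (norm_le_enorm _)).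
      exact: le_trans pr (ler_norm _).
    by move: Ld; rewrite dotBl !ler_norml; lra.
  move=> xy; rewrite ler_norml.
  have := half _ _ xy; rewrite tdist2C in xy; have := half _ _ xy; lra.
- exists (n%:R * G); first by rewrite mulr_ge0.
  move=> i x p q; rewrite ler_norml.
  have := Hlip i x p q; have := Hlip i x q p; rewrite (distrC q p); lra.
- move=> M.
  have [||r Hr] := @finite_large R m (fun i r => forall x p,
    hamiltonian g L i x p <= M -> enorm p <= r).
  + by move=> i r r' rr' Hr x p /Hr /le_trans; exact.
  + move=> i; have [r Hr] := coer i M; exists r => x p; apply: contraTT.
    rewrite -!ltNge => /Hr /lt_le_trans; apply; apply: ge_inf; last by exists x.
    exists (- (n%:R * G * `|p| + Lb)) => _ [y _ <-]; case: Xi0 => xi _.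
    apply: (@le_trans _ _ (- dot (g i (y, xi)) p - L i (y, xi))).
      have := dotG i (y, xi) p; have := LbP i (y, xi); rewrite !ler_norml; lra.
    by apply: ub_le_sup => //; exists xi.
  by exists r => i x p; exact: Hr.
Qed.

(** * Monotone matrices *)

(** A crude operator norm for the maximum norm. *)
Definition entry_sum (R : realType) (m : nat) (B : 'M[R]_m) : R :=
  \sum_i \sum_j `|B i j|.

Section Matrix.
Context {R : realType} {m : nat}.
Implicit Types (B : 'M[R]_m) (U V : 'cV[R]_m).

Lemma entry_sum_ge0 B : 0 <= entry_sum B.
Proof. by do 2 (apply: sumr_ge0 => ? _). Qed.

Lemma entry_le_sum B i j : `|B i j| <= entry_sum B.
Proof.
apply: (@le_trans _ _ (\sum_j `|B i j|)).
  by rewrite (bigD1 j)//= lerDl sumr_ge0.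
by rewrite /entry_sum [leRHS](bigD1 i)//= lerDl; do 2 (apply: sumr_ge0 => ? _).
Qed.

Lemma mulmx_entry_le B U (e : R) k : 0 <= e -> (forall i, `|U i ord0| <= e) ->
  `|(B *m U) k ord0| <= entry_sum B * e.
Proof.
move=> e0 Ue; rewrite mxE; apply: (le_trans (ler_norm_sum _ _ _)).
apply: (@le_trans _ _ ((\sum_j `|B k j|) * e)).
  by rewrite mulr_suml; apply: ler_sum => j _; rewrite normrM ler_wpM2l.
rewrite ler_wpM2r// /entry_sum [leRHS](bigD1 k)//= lerDl.
by do 2 (apply: sumr_ge0 => ? _).
Qed.

(** Raising the entry [k] from an approximate to an exact maximum puts the definition of
monotonicity in force; the correction costs at most [e] times the diagonal entry. *)
Lemma monotone_mx_approx B U k (M e : R) : monotone_mx B ->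
  0 <= M -> (forall i, U i ord0 <= M) -> M - e <= U k ord0 ->
  - (entry_sum B * e) <= (B *m U) k ord0.
Proof.
move=> hB M0 UM Uk.
pose U' := U + (M - U k ord0) *: delta_mx k ord0.
have U'E i : U' i ord0 = U i ord0 + (M - U k ord0) * (i == k)%:R.
  by rewrite !mxE eqxx andbT.
have U'k : U' k ord0 = M by rewrite U'E eqxx mulr1; lra.
have U'le i : U' i ord0 <= U' k ord0.
  rewrite U'k U'E; case: eqP => [->|_]; first by rewrite mulr1; lra.
  by rewrite mulr0 addr0.
have := hB U' k U'le; rewrite U'k => /(_ M0).
rewrite mulmxDr -scalemxAr mxE [X in _ + X]mxE.
have -> : (B *m delta_mx k ord0 : 'cV[R]_m) k ord0 = B k k.
  by rewrite -colE mxE.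
have Mk : 0 <= M - U k ord0 by rewrite subr_ge0.
have : (M - U k ord0) * B k k <= entry_sum B * e.
  apply: (le_trans (ler_norm _)); rewrite normrM mulrC ler_pM//.
    exact: entry_le_sum.
  by rewrite ger0_norm//; lra.
lra.
Qed.

(** If [U] lies in the kernel, then up to sign its entry of largest absolute value is a
positive maximum [U k], and monotonicity gives [0 < la * U k + (B U) k = 0]. *)
Lemma monotone_mx_unit B (la : R) : monotone_mx B -> 0 < la ->
  la%:M + B \in unitmx.
Proof.
move=> hB la0; rewrite -unitmx_tr -row_free_unit -kermx_eq0.
apply/negPn/negP => /rowV0Pn[v /sub_kermxP vA v0].
have AU : (la%:M + B) *m v^T = 0.
  by apply: trmx_inj; rewrite trmx_mul trmxK trmx0.
have [j vj] : exists j, v ord0 j != 0.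
  by apply/existsP; apply: contraNT v0 => /existsPn v0; apply/eqP/rowP => j;
     rewrite mxE; apply/eqP/negPn/v0.
have [k kmax] := finite_max (fun i => `|v ord0 i|) j.
have key (U : 'cV[R]_m) : (la%:M + B) *m U = 0 ->
    (forall i, U i ord0 <= U k ord0) -> 0 < U k ord0 -> False.
  move=> /(congr1 (fun A : 'cV_m => A k ord0)).
  rewrite mulmxDl mul_scalar_mx !mxE => + Umax U0.
  have := hB U k Umax (ltW U0); rewrite mxE.
  have := mulr_gt0 la0 U0; lra.
have vk0 : 0 < `|v ord0 k| by apply: lt_le_trans (kmax j); rewrite normr_gt0.
have [vk|vk] := leP 0 (v ord0 k).
  apply: (key v^T AU) => [i|]; rewrite !mxE.
    by apply: (le_trans (ler_norm _)); have := kmax i; rewrite (ger0_norm vk).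
  by rewrite (ger0_norm vk) in vk0.
apply: (key (- v^T)) => [|i|]; first by rewrite mulmxN AU oppr0.
  rewrite !mxE; apply: (le_trans (ler_norm _)); rewrite normrN.
  by have := kmax i; rewrite (ltr0_norm vk).
by rewrite !mxE oppr_gt0.
Qed.

End Matrix.

(** * Maxima with doubled variables *)

Section Coordinates.
Context {R : realType} {n : nat}.

Lemma C_torus_coord m (u : 'rV[R]_n -> 'cV[R]_m) i :
  C_torus u -> C_torus (fun x => u x i ord0).
Proof.
move=> [cu pu]; split=> [x|z x]; last by rewrite pu.
by apply: (@continuous_comp _ _ _ u (fun U : 'cV[R]_m => U i ord0));
     [exact: cu|exact: coord_continuous].
Qed.

Lemma C_torusZ (a : R) (f : 'rV[R]_n -> R) :
  C_torus f -> C_torus (fun x => a * f x).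
Proof.
move=> [cf pf]; split=> [x|z x]; last by rewrite pf.
by apply: (continuousM _ (cf x)); exact: cst_continuous.
Qed.

(** Periodicity in each of the three variables reduces this to a product of cubes. *)
Lemma doubling_max (N : R) (f1 f2 f3 : 'rV[R]_n -> R) :
  C_torus f1 -> C_torus f2 -> C_torus f3 ->
  let Phi (t : 'rV[R]_n * 'rV[R]_n * 'rV[R]_n) :=
    f1 t.1.1 + f2 t.1.2 - f3 t.2
    - N * (tdist2 (t.1.1 - t.2) + tdist2 (t.1.2 - t.2)) in
  exists t0, forall t, Phi t <= Phi t0.
Proof.
move=> [c1 p1] [c2 p2] [c3 p3] Phi.
pose T := ('rV[R]_n * 'rV[R]_n * 'rV[R]_n)%type.
have q1 : continuous (fun t : T => t.1.1).
  by move=> t; apply: (@continuous_comp _ _ _ fst fst); exact: cvg_fst.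
have q2 : continuous (fun t : T => t.1.2).
  by move=> t; apply: (@continuous_comp _ _ _ fst snd); [exact: cvg_fst|exact: cvg_snd].
have q3 : continuous (fun t : T => t.2) by move=> t; exact: cvg_snd.
have comp (f : 'rV[R]_n -> R) (q : T -> 'rV[R]_n) :
    continuous f -> continuous q -> continuous (f \o q).
  by move=> cf cq t; apply: (@continuous_comp _ _ _ q f); [exact: cq|exact: cf].
have diff (q q' : T -> 'rV[R]_n) : continuous q -> continuous q' ->
    continuous (fun t => tdist2 (q t - q' t)).
  move=> cq cq'; apply: (comp _ (fun t => q t - q' t) continuous_tdist2).
  by move=> t; exact: (continuousB (cq t) (cq' t)).
apply: torus3_max.
- move=> t; apply: (@continuousB _ _ _ (fun t : T => f1 t.1.1 + f2 t.1.2 - f3 t.2)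
      (fun t : T => N * (tdist2 (t.1.1 - t.2) + tdist2 (t.1.2 - t.2)))).
    apply: (@continuousB _ _ _ (fun t : T => f1 t.1.1 + f2 t.1.2)
      (fun t => f3 t.2)).
      exact: (continuousD (comp _ _ c1 q1 t) (comp _ _ c2 q2 t)).
    exact: (comp _ _ c3 q3 t).
  apply: (@continuousM R _ (cst N)
    (fun t : T => tdist2 (t.1.1 - t.2) + tdist2 (t.1.2 - t.2))).
    exact: cst_continuous.
  exact: (continuousD (diff _ _ q1 q3 t) (diff _ _ q2 q3 t)).
- by move=> y z v x; rewrite /Phi /= p1 [x + _ - _]addrAC tdist2_periodic.
- by move=> x z v y; rewrite /Phi /= p2 [y + _ - _]addrAC tdist2_periodic.
- move=> x y v z; rewrite /Phi /= p3 (tdist2C x) (tdist2C y).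
  by rewrite ![z + _ - _]addrAC !tdist2_periodic !(tdist2C z).
Qed.

Lemma torus_bounded m (u : 'rV[R]_n -> 'cV[R]_m) : C_torus u ->
  exists2 C, 0 <= C & forall x i, `|u x i ord0| <= C.
Proof.
move=> [cu pu]; have [|x0 max0] := @torus_max R n (fun x => `|u x|).
  split=> [x|z x]; last by rewrite pu.
  by apply: (@continuous_comp _ _ _ u Num.norm);
     [exact: cu|exact: norm_continuous].
exists `|u x0| => // x i; exact: le_trans (coord_le_norm _ _ _) (max0 x).
Qed.

End Coordinates.

(** * Convex combinations of subsolutions against a supersolution *)

Section Comparison.
Context {R : realType} {m n : nat}.
Variables (H : 'I_m -> 'rV[R]_n -> 'rV[R]_n -> R) (B : 'M[R]_m) (c : 'cV[R]_m).
Hypotheses (hH : convex_coercive H) (hB : monotone_mx B).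

(** Approximate form of the following fact: at a nonnegative maximum of
[W = a u1 + b u2 - w] over all components and all points, the zeroth order terms
of the two subsolutions combine to at most that of the supersolution.

The three functions are evaluated at separate points [x], [y], [z], and the penalty
[N (tdist2 (x - z) + tdist2 (y - z))] keeps these together. At the maximum the
momenta [p1], [p2] seen by [u1], [u2] and the momentum seen by [w] are related by
[q = a p1 + b p2], so convexity of [H] disposes of the Hamiltonian terms, and
monotonicity of [B] of the coupling terms. Coercivity bounds [p1] and [p2]
independently of [N], which makes the dependence of [H] on [x] negligible.
The estimate holds up to [eta] at some point, so no limit of the maximum points
has to be extracted. *)
Lemma convex_combination_touching (la1 la2 nu a b : R)
    (u1 u2 w : 'rV[R]_n -> 'cV[R]_m) (j : 'I_m) (x0 : 'rV[R]_n) :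
  0 < a -> 0 < b -> a + b = 1 ->
  viscosity_subsolution la1 B H c u1 -> viscosity_subsolution la2 B H c u2 ->
  viscosity_supersolution nu B H c w ->
  let W i x := a * u1 x i ord0 + b * u2 x i ord0 - w x i ord0 in
  0 <= W j x0 -> forall eta : R, 0 < eta -> exists k z,
    W j x0 <= W k z + eta /\
    a * (la1 * u1 z k ord0) + b * (la2 * u2 z k ord0) <= nu * w z k ord0 + eta.
Proof.
move=> a0 b0 ab [u1C sub1] [u2C sub2] [wC supw] W W0 eta eta0.
have WC i : C_torus (W i).
  have [c1 p1] := C_torus_coord i u1C; have [c2 p2] := C_torus_coord i u2C.
  have [c3 p3] := C_torus_coord i wC.
  split=> [x|z x]; last by rewrite /W p1 p2 p3.
  apply: (continuousB _ (c3 x)).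
  apply: (@continuousD _ _ _ (fun x => a * u1 x i ord0) (fun x => b * u2 x i ord0)).
    by apply: (continuousM _ (c1 x)); exact: cst_continuous.
  by apply: (continuousM _ (c2 x)); exact: cst_continuous.
have [k0 [z0 Wmax]] : exists k0 z0, forall i x, W i x <= W k0 z0.
  have /choice[y ymax] i := torus_max (WC i).
  have [k0 k0max] := finite_max (fun i => W i (y i)) j.
  by exists k0, (y k0) => i x; exact: le_trans (ymax i x) (k0max i).
have M0 : 0 <= W k0 z0 by exact: le_trans W0 (Wmax _ _).
have [C1 C10 bd1] := torus_bounded u1C.
have [C2 C20 bd2] := torus_bounded u2C.
have [C3 C30 bd3] := torus_bounded wC.
have be0 := entry_sum_ge0 B; set be := entry_sum B in be0.
(* [T * e] bounds the sum of all errors below. *)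
pose T := `|la1| + `|la2| + 2 * be + 2.
have T0 : 0 < T by have := normr_ge0 la1; have := normr_ge0 la2; rewrite /T; lra.
pose e := eta / T.
have e0 : 0 < e by rewrite divr_gt0.
have [r Hr] := ham_sublevel hH (`|c| + (`|la1| + be) * C1 + (`|la2| + be) * C2).
have [d1 d10 D1] := torus_unif_cont u1C e0.
have [d2 d20 D2] := torus_unif_cont u2C e0.
have [d3 d30 D3] := ham_unif hH r e0.
pose d := Num.min d1 (Num.min d2 d3).
have d0 : 0 < d by rewrite !lt_min d10 d20.
(* At the maximum the penalty is less than [C1 + C2 + C3 + 1], so the penalised
   distances are less than [d]. *)
pose N := (C1 + C2 + C3 + 1) / d.
have N0 : 0 < N by rewrite divr_gt0//; lra.
pose Phi i (t : 'rV[R]_n * 'rV[R]_n * 'rV[R]_n) :=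
  a * u1 t.1.1 i ord0 + b * u2 t.1.2 i ord0 - w t.2 i ord0
  - N * (tdist2 (t.1.1 - t.2) + tdist2 (t.1.2 - t.2)).
have [k [x [y [z Phimax]]]] :
    exists k x y z, forall i t, Phi i t <= Phi k (x, y, z).
  have /choice[t tmax] : forall i, exists t0, forall t, Phi i t <= Phi i t0.
    move=> i.
    exact: (doubling_max N (C_torusZ a (C_torus_coord i u1C))
      (C_torusZ b (C_torus_coord i u2C)) (C_torus_coord i wC)).
  have [k kmax] := finite_max (fun i => Phi i (t i)) j.
  exists k, (t k).1.1, (t k).1.2, (t k).2 => i s.
  by case: (t k) (kmax i) => -[? ?] ? /=; exact: le_trans (tmax i s).
have PhiM : W k0 z0 <= Phi k (x, y, z).
  apply: le_trans (Phimax k0 (z0, z0, z0)).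
  by rewrite /Phi /= subrr tdist20 addr0 mulr0 subr0.
have a1 : a <= 1 by lra.
have b1 : b <= 1 by lra.
have au1 i v : `|a * u1 v i ord0| <= C1.
  by rewrite normrM gtr0_norm// -[leRHS]mul1r ler_pM// ltW.
have bu2 i v : `|b * u2 v i ord0| <= C2.
  by rewrite normrM gtr0_norm// -[leRHS]mul1r ler_pM// ltW.
have pen : tdist2 (x - z) + tdist2 (y - z) < d.
  have : N * (tdist2 (x - z) + tdist2 (y - z)) < C1 + C2 + C3 + 1.
    have := le_trans M0 PhiM; rewrite /Phi /=.
    have := au1 k x; have := bu2 k y; have := bd3 z k; rewrite !ler_norml; lra.
  by rewrite /N mulrAC ltr_pdivrMr// ltr_pM2l//; lra.
have xz0 := tdist2_ge0 (x - z); have yz0 := tdist2_ge0 (y - z).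
have xzd : tdist2 (x - z) < d by lra.
have yzd : tdist2 (y - z) < d by lra.
move: (xzd) (yzd); rewrite !lt_min => /and3P[xz1 xz2 xz3] /and3P[yz1 yz2 yz3].
pose p1 := (N / a) *: dtdist2 (x - z); pose p2 := (N / b) *: dtdist2 (y - z).
(* Fixing two of the three points leaves a maximum in the remaining variable. *)
have S1 : la1 * u1 x k ord0 + (B *m u1 x) k ord0 + H k x p1 <= c k ord0.
  have := sub1 k (fun v => N / a * tdist2 (v - z)) x (C1_torusZ _ (C1_tdist2 z)).
  rewrite gradZ ?grad_tdist2; last by have [] := C1_tdist2 z.
  apply=> v; rewrite -(ler_pM2l a0) !mulrBr.
  rewrite ![a * (N / a * _)]mulrA [a * (N / a)]mulrC divfK ?gt_eqF//.
  by have := Phimax k (v, y, z); rewrite /Phi /=; lra.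
have S2 : la2 * u2 y k ord0 + (B *m u2 y) k ord0 + H k y p2 <= c k ord0.
  have := sub2 k (fun v => N / b * tdist2 (v - z)) y (C1_torusZ _ (C1_tdist2 z)).
  rewrite gradZ ?grad_tdist2; last by have [] := C1_tdist2 z.
  apply=> v; rewrite -(ler_pM2l b0) !mulrBr.
  rewrite ![b * (N / b * _)]mulrA [b * (N / b)]mulrC divfK ?gt_eqF//.
  by have := Phimax k (x, v, z); rewrite /Phi /=; lra.
have S3 : c k ord0 <=
    nu * w z k ord0 + (B *m w z) k ord0 + H k z (a *: p1 + b *: p2).
  have C1f := C1_torusD (C1_tdist2 x) (C1_tdist2 y).
  have := supw k _ z (C1_torusZ (- N) C1f).
  rewrite gradZ; last by have [] := C1f.
  rewrite gradD; [|by have [] := C1_tdist2 x|by have [] := C1_tdist2 y].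
  rewrite !grad_tdist2 -(opprB x) -(opprB y) !dtdist2N -opprD scalerN scaleNr opprK.
  rewrite scalerDr /p1 /p2 !scalerA ![_ * (N / _)]mulrC !divfK ?gt_eqF//.
  apply=> v /=; rewrite -!(tdist2C x) -!(tdist2C y).
  by have := Phimax k (x, y, v); rewrite /Phi /=; lra.
have pbound la C (u : 'rV[R]_n -> 'cV[R]_m) v p :
    (forall x i, `|u x i ord0| <= C) -> 0 <= C ->
    la * u v k ord0 + (B *m u v) k ord0 + H k v p <= c k ord0 ->
    H k v p <= `|c| + (`|la| + be) * C.
  move=> uC C0' S.
  have := le_trans (ler_norm _) (coord_le_norm c k ord0).
  have := mulmx_entry_le B k C0' (uC v).
  have : `|la * u v k ord0| <= `|la| * C by rewrite normrM ler_wpM2l.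
  by rewrite -/be !ler_norml; lra.
have r1 : enorm p1 <= r.
  apply: (Hr k x); apply: (le_trans (pbound _ _ _ _ _ bd1 C10 S1)).
  by rewrite lerDl mulr_ge0// addr_ge0.
have r2 : enorm p2 <= r.
  apply: (Hr k y); apply: (le_trans (pbound _ _ _ _ _ bd2 C20 S2)).
  by rewrite lerD2r lerDl mulr_ge0// addr_ge0.
have shift la (u : 'rV[R]_n -> 'cV[R]_m) v p : `|u v - u z| < e ->
    `|H k v p - H k z p| <= e ->
    la * u v k ord0 + (B *m u v) k ord0 + H k v p <= c k ord0 ->
    la * u z k ord0 + (B *m u z) k ord0 + H k z p <=
      c k ord0 + (`|la| + be + 1) * e.
  move=> uvz Hvz S.
  have uvzi i : `|(u v - u z) i ord0| <= e.
    exact: le_trans (coord_le_norm _ _ _) (ltW uvz).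
  have := mulmx_entry_le B k (ltW e0) uvzi.
  have : `|la * (u v k ord0 - u z k ord0)| <= `|la| * e.
    by rewrite normrM ler_wpM2l//; have := uvzi k; rewrite !mxE.
  have -> : (B *m (u v - u z)) k ord0 = (B *m u v) k ord0 - (B *m u z) k ord0.
    by rewrite mulmxBr !mxE.
  by rewrite -/be; move: Hvz; rewrite !ler_norml; lra.
have T1 := shift _ _ _ _ (D1 _ _ xz1) (D3 _ _ _ _ r1 xz3) S1.
have T2 := shift _ _ _ _ (D2 _ _ yz2) (D3 _ _ _ _ r2 yz3) S2.
have cvx := ham_convex hH k z p1 p2 (ltW a0) (ltW b0) ab.
have close (u : 'rV[R]_n -> 'cV[R]_m) h v : 0 < h -> `|u v - u z| < e ->
    h * u v k ord0 <= h * u z k ord0 + h * e.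
  move=> h0 uvz; rewrite -mulrDr ler_pM2l//.
  have := le_lt_trans (coord_le_norm _ k ord0) uvz.
  by rewrite !mxE ltr_norml; lra.
have Wz : W k0 z0 - e <= W k z.
  have := close _ _ _ a0 (D1 _ _ xz1); have := close _ _ _ b0 (D2 _ _ yz2).
  have Npen : 0 <= N * (tdist2 (x - z) + tdist2 (y - z)).
    by rewrite mulr_ge0 ?(ltW N0)// addr_ge0.
  have abe : a * e + b * e = e by rewrite -mulrDl ab mul1r.
  move: PhiM; rewrite /Phi /=; set M := W k0 z0; rewrite /W; lra.
have eE : e * T = eta by rewrite divfK ?gt_eqF.
have [la1_ge0 la2_ge0] : 0 <= `|la1| * e /\ 0 <= `|la2| * e.
  by split; rewrite mulr_ge0// ltW.
have bee : 0 <= be * e by rewrite mulr_ge0// ltW.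
exists k, z; split.
  by apply: (le_trans (Wmax _ _)); move: eE; rewrite /T; lra.
have Ucoord i : (a *: u1 z + b *: u2 z - w z) i ord0 = W i z by rewrite !mxE.
have : - (be * e) <= (B *m (a *: u1 z + b *: u2 z - w z)) k ord0.
  by apply: (monotone_mx_approx hB M0) => [i|]; rewrite Ucoord.
have -> : (B *m (a *: u1 z + b *: u2 z - w z)) k ord0 =
    a * (B *m u1 z) k ord0 + b * (B *m u2 z) k ord0 - (B *m w z) k ord0.
  rewrite mulmxBr mulmxDr -!scalemxAr.
  by move: (B *m u1 z) (B *m u2 z) (B *m w z) => X1 X2 X3; rewrite !mxE.
have := ler_wpM2l (ltW a0) T1; have := ler_wpM2l (ltW b0) T2.
have ce : a * c k ord0 + b * c k ord0 = c k ord0 by rewrite -mulrDl ab mul1r.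
have abe : a * (be * e) + b * (be * e) = be * e by rewrite -mulrDl ab mul1r.
have abe1 : a * e + b * e = e by rewrite -mulrDl ab mul1r.
have : a * (`|la1| * e) <= `|la1| * e by rewrite ler_piMl.
have : b * (`|la2| * e) <= `|la2| * e by rewrite ler_piMl.
by move: eE; rewrite /T; lra.
Qed.

(** The special case [u1 = u2 = u], where all discounts agree. *)
Lemma comparison (nu : R) u w : 0 < nu ->
  viscosity_subsolution nu B H c u -> viscosity_supersolution nu B H c w ->
  forall i x, u x i ord0 <= w x i ord0.
Proof.
move=> nu0 subu supw i x; rewrite -subr_le0 leNgt; apply/negP => s0.
set s := _ - _ in s0.
have half : 2^-1 + 2^-1 = 1 :> R by lra.
have h0 : 0 < 2^-1 :> R by [].
have hE v j : 2^-1 * u v j ord0 + 2^-1 * u v j ord0 - w v j ord0 =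
    u v j ord0 - w v j ord0.
  by rewrite -mulrDl half mul1r.
pose eta := s / (2 * (1 + nu^-1)).
have den : 0 < 1 + nu^-1 by rewrite addr_gt0// invr_gt0.
have eta0 : 0 < eta by rewrite divr_gt0// mulr_gt0.
have [|k [z]] := convex_combination_touching h0 h0 half subu subu supw
  (j := i) (x0 := x) _ eta0.
  by rewrite /= hE ltW.
rewrite /= !hE -mulrDl half mul1r -/s => -[s_le nu_le].
have : u z k ord0 - w z k ord0 <= eta / nu.
  by rewrite ler_pdivlMr// mulrC mulrBr; lra.
have : eta * (1 + nu^-1) = s / 2.
  by rewrite /eta invfM mulrA divfK ?gt_eqF.
lra.
Qed.

(** The property that forces convergence. With [a = nu / la], the combination
[a u + (1 - a) z] satisfies the inequality of a subsolution for the discount [nu]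
with zeroth order term [nu u] in place of [nu (a u + (1 - a) z)]; the two differ by
[nu (1 - a) (z - u)], at most [nu (1 - a) theta]. Hence
[a u + (1 - a) z - (1 - a) theta] is a subsolution and lies below [v], and
[z - v <= a (z - u) + (1 - a) theta <= theta]. The sign of [theta] enters through
[B]: subtracting a nonnegative constant does not increase the coupling terms. *)
Lemma critical_gap_monotone (la nu theta : R) z u v :
  0 < nu -> nu < la -> 0 <= theta ->
  viscosity_subsolution 0 B H c z -> viscosity_subsolution la B H c u ->
  viscosity_supersolution nu B H c v ->
  (forall i x, z x i ord0 - u x i ord0 <= theta) ->
  forall i x, z x i ord0 - v x i ord0 <= theta.
Proof.
move=> nu0 nula theta0 subz subu supv zu i x.
have la0 : 0 < la := lt_trans nu0 nula.
pose a := nu / la; pose b := 1 - a.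
have a0 : 0 < a by rewrite divr_gt0.
have b0 : 0 < b by rewrite subr_gt0 ltr_pdivrMr// mul1r.
have ab : a + b = 1 by rewrite /b; ring.
have ala : a * la = nu by rewrite divfK ?gt_eqF.
pose W i x := a * u x i ord0 + b * z x i ord0 - v x i ord0.
have WE j y : z y j ord0 - v y j ord0 = W j y + a * (z y j ord0 - u y j ord0).
  by rewrite /W /b; ring.
suff : W i x <= b * theta.
  rewrite WE; have := ler_wpM2l (ltW a0) (zu i x).
  have : a * theta + b * theta = theta by rewrite -mulrDl ab mul1r.
  lra.
have [W0|/ltW W0] := leP 0 (W i x); last first.
  by rewrite (le_trans W0)// mulr_ge0// ltW.
apply/ler_addgt0Pr => eta eta0.
pose e := eta / (1 + nu^-1).
have den : 0 < 1 + nu^-1 by rewrite addr_gt0// invr_gt0.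
have e0 : 0 < e by rewrite divr_gt0.
have [k [y [Wle]]] := convex_combination_touching a0 b0 ab subu subz supv W0 e0.
rewrite mul0r mulr0 addr0 mulrA ala => nule.
have : u y k ord0 - v y k ord0 <= e / nu.
  by rewrite ler_pdivlMr// mulrC mulrBr; lra.
have := ler_wpM2l (ltW b0) (zu k y).
have : e * (1 + nu^-1) = eta by rewrite divfK ?gt_eqF.
have : W k y = u y k ord0 - v y k ord0 + b * (z y k ord0 - u y k ord0).
  by rewrite /W /b; ring.
move: Wle; rewrite -/(W i x) -/(W k y); lra.
Qed.

End Comparison.

(** * Lipschitz bounds from bounded test gradients *)

(** Stated over an abstract space, where the neighbourhood filter does not unfold to a
product filter as it does on row vectors. *)
Lemma continuous_dist_le {R : realType} (T : topologicalType) (f : T -> R)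
    (t : T) :
  (forall e, 0 < e -> \forall y \near t, `|f t - f y| <= e) ->
  {for t, continuous f}.
Proof. by move=> H; apply/cvgrPdist_le. Qed.

Lemma near_le_of_continuous {R : realType} (T : topologicalType) (f : T -> R)
    (t : T) (e : R) :
  {for t, continuous f} -> f t < e -> \forall y \near t, f y <= e.
Proof. by move=> cf fte; apply: (cvgr_le _ cf). Qed.

Lemma right0_nearP {R : realType} (P : R -> Prop) :
  (\forall x \near 0^'+, P x) <-> exists2 d, 0 < d & forall x, 0 < x < d -> P x.
Proof.
split=> [[d /= d0 dP]|[d d0 dP]].
  exists d => // x /andP[x0 xd]; apply: dP => //=.
  by rewrite sub0r normrN gtr0_norm.
near=> x; apply: dP; apply/andP; split; near: x.
  exact: nbhs_right_gt.
exact: nbhs_right_lt.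
Unshelve. all: by end_near. Qed.

Section Regularity.
Context {R : realType} {n : nat}.
Implicit Types (x y : 'rV[R]_n) (f : 'rV[R]_n -> R).

Lemma dotZZ (a : R) (p : 'rV[R]_n) : dot (a *: p) (a *: p) = a ^+ 2 * dot p p.
Proof. by rewrite /dot mulr_sumr; apply: eq_bigr => k _; rewrite !mxE; ring. Qed.

(** Touch [f] from above by [K sqrt (tdist2 (. - x) + d^2)], a smooth approximation of a
cone of slope at least [K > r]. Since [f] is bounded and [K] is large, the touching
point is close to [x] modulo the lattice, where [dot_dtdist2] applies; if its squared
distance to [x] were at least [d^2], the test function would have a gradient of norm
at least [K] there. So the touching point tends to [x] as [d] tends to 0. *)
Lemma subgradient_bound_lipschitz f (C r : R) : C_torus f ->
  (forall x, `|f x| <= C) ->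
  (forall psi x, C1_torus psi -> (forall y, f y - psi y <= f x - psi x) ->
     enorm (grad psi x) <= r) ->
  forall x y, f y - f x <= (`|r| + 8 * C + 1) * Num.sqrt (tdist2 (y - x)).
Proof.
move=> fC fb fr x y; set K := `|r| + 8 * C + 1.
have C0 : 0 <= C by apply: le_trans (fb x).
have r_lt_K : r < K by have := ler_norm r; rewrite /K; lra.
have CK : 8 * C <= K by have := normr_ge0 r; rewrite /K; lra.
have K0 : 0 < K by have := normr_ge0 r; rewrite /K; lra.
apply/ler_addgt0Pr => eta eta0.
have eta2 : 0 < eta / 2 by rewrite divr_gt0.
have [d0 d00 D0] := torus_unif_cont fC eta2.
pose d := Num.min 4^-1 (Num.min d0 (eta / 2 / K)).
have d_gt0 : 0 < d by rewrite !lt_min d00 invr_gt0 ltr0n /= divr_gt0.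
have : d <= d by [].
rewrite {2}/d !le_min => /and3P[d4 dd0 deta].
have d2_le_d : d ^+ 2 <= d by rewrite expr2 ler_piMr ?(ltW d_gt0)//; lra.
have d2_gt0 : 0 < d ^+ 2 by rewrite exprn_gt0.
pose phi v : R := tdist2 (v - x) + d ^+ 2.
have phi_gt0 v : 0 < phi v by rewrite ltr_wpDl// tdist2_ge0.
have C1phi : C1_torus phi := C1_torusD (C1_tdist2 x) (C1_torus_cst (d ^+ 2)).
pose S v := Num.sqrt (phi v).
have C1psi : C1_torus (fun v => K * S v).
  exact: (C1_torusZ K (C1_torus_sqrt C1phi phi_gt0)).
have [w maxw] : exists w, forall v, f v - K * S v <= f w - K * S w.
  have [cf pf] := fC; have [cpsi ppsi] := C1_torus_cont C1psi.
  apply: (@torus_max R n (fun v => f v - K * S v)); split=> [v|z v].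
    exact: (continuousB (cf v) (cpsi v)).
  by rewrite pf ppsi.
have Sx : S x = d by rewrite /S /phi subrr tdist20 add0r sqrtr_sqr gtr0_norm.
have S_ge0 v : 0 <= S v by exact: sqrtr_ge0.
have S_gt0 v : 0 < S v by rewrite sqrtr_gt0.
have S2 v : S v ^+ 2 = tdist2 (v - x) + d ^+ 2 by rewrite sqr_sqrtr// ltW.
have w_near : tdist2 (w - x) < d ^+ 2.
  rewrite ltNge; apply/negP => far.
  (* [K (S w - d) <= 2 C], while [K >= 8 C] and [d <= 1/4]. *)
  have Sw : S w <= 2^-1.
    rewrite -(ler_pM2l K0); have := maxw x; rewrite Sx.
    have := fb x; have := fb w; rewrite !ler_norml.
    have : K * d <= K * 4^-1 by rewrite ler_pM2l.
    lra.
  have : tdist2 (w - x) <= 2^-1.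
    have : S w ^+ 2 <= 2^-1 ^+ 2 by rewrite ler_sqr ?nnegrE.
    by rewrite S2; lra.
  move=> /dot_dtdist2 dotw.
  have := fr _ _ C1psi maxw; apply/negP; rewrite -ltNge.
  apply: (lt_le_trans r_lt_K).
  have [_ dphi _] := C1phi; have [_ dpsi _] := C1_torus_sqrt C1phi phi_gt0.
  rewrite gradZ//.
  have [_ ->] := grad_sqrt (dphi w) (phi_gt0 w).
  have -> : grad phi w = dtdist2 (w - x).
    rewrite /phi gradD; [|by have [] := C1_tdist2 x|
      by have [] := @C1_torus_cst R n (d ^+ 2)].
    rewrite grad_tdist2.
    by apply/rowP => k; rewrite !mxE derive_cst addr0.
  rewrite scalerA /enorm dotZZ -[leLHS]gtr0_norm// -sqrtr_sqr.
  apply: ler_wsqrtr; rewrite exprMn -mulrA ler_peMr ?sqr_ge0//.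
  rewrite exprVn exprMn -/(S w) ler_pdivlMl ?mulr1;
    last by rewrite mulr_gt0// exprn_gt0.
  apply: le_trans dotw; rewrite S2.
  have : 2 ^+ 2 <= pi ^+ 2 :> R by rewrite ler_sqr ?nnegrE ?pi_ge2// pi_ge0.
  move=> /(ler_wpM2r (tdist2_ge0 (w - x))); lra.
have fw : f w <= f x + eta / 2.
  have /D0 : tdist2 (w - x) < d0 by lra.
  by rewrite ltr_norml; lra.
have Sy : S y <= Num.sqrt (tdist2 (y - x)) + d.
  rewrite -[leRHS]ger0_norm ?addr_ge0 ?sqrtr_ge0 ?(ltW d_gt0)// -sqrtr_sqr.
  apply: ler_wsqrtr; rewrite sqrrD sqr_sqrtr ?tdist2_ge0//.
  rewrite /phi -addrA lerD2l lerDr.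
  by rewrite mulrn_wge0// mulr_ge0 ?sqrtr_ge0// ltW.
have := maxw y.
have : 0 <= K * S w by rewrite mulr_ge0// ltW.
have := ler_wpM2l (ltW K0) Sy.
have : K * d <= eta / 2 by rewrite mulrC -ler_pdivlMr.
lra.
Qed.

Lemma gauge_small x (K e : R) : 0 < e ->
  \forall y \near x, K * Num.sqrt (tdist2 (y - x)) <= e.
Proof.
move=> e0.
have c : {for x, continuous (fun y => K * Num.sqrt (tdist2 (y - x)))}.
  apply: (@continuousM R _ (cst K)); first exact: cst_continuous.
  apply: (@continuous_comp _ _ _ (fun y => tdist2 (y - x)) Num.sqrt).
    by have [cont _] := C1_torus_cont (C1_tdist2 x); exact: cont.
  exact: sqrt_continuous.
by apply: (near_le_of_continuous c); rewrite subrr tdist20 sqrtr0 mulr0.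
Qed.

Lemma gauge_lipschitz_continuous f (K : R) :
  (forall x y, f y - f x <= K * Num.sqrt (tdist2 (y - x))) -> continuous f.
Proof.
move=> fK x; apply: (@continuous_dist_le _ 'rV[R]_n) => e e0.
near=> y.
have Ky : K * Num.sqrt (tdist2 (y - x)) <= e by near: y; exact: gauge_small.
have := fK x y; have := fK y x; rewrite (tdist2C x y) ler_norml; lra.
Unshelve. all: by end_near. Qed.

End Regularity.

(** * Uniform cluster points of equi-Lipschitz families *)

Section Cluster.
Context {R : realType} {n m : nat}.

Lemma ultra_bounded_limit (T : Type) (G : set_system T) (f : T -> R) (C : R) :
  UltraFilter G -> G [set t | `|f t| <= C] ->
  exists l, forall e, 0 < e -> G [set t | `|f t - l| <= e].
Proof.
move=> GU GC.
have [l [_ cl]] : `[- C, C]%classic `&` cluster (f @ G) !=set0.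
  apply: segment_compact; rewrite /fmap /=; apply: filterS GC => t /=.
  by rewrite in_itv/= ler_norml.
exists l => e e0; have [//|Gc] := in_ultra_setVsetC [set t | `|f t - l| <= e] GU.
have [y []] := cl [set y | ~ (`|y - l| <= e)] (ball l e) Gc (nbhsx_ballx l e e0).
by move=> /= /negP; rewrite -ltNge distrC => /lt_trans h /h; rewrite ltxx.
Qed.

(** An Ascoli theorem. Along an ultrafilter finer than [S] and [0^'+] the bounded
functions converge at every point; the Lipschitz bound, uniform in the parameter,
and compactness of the cube make the convergence uniform. *)
Lemma equilipschitz_cluster (u : R -> 'rV[R]_n -> 'cV[R]_m) (S : set R) (C K : R) :
  (forall la, 0 < la <= 1 -> zperiodic (u la)) ->
  (forall la, 0 < la <= 1 -> forall x i, `|u la x i ord0| <= C) ->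
  (forall la, 0 < la <= 1 -> forall i x y,
     u la y i ord0 - u la x i ord0 <= K * Num.sqrt (tdist2 (y - x))) ->
  (forall d, 0 < d -> exists2 la, S la & 0 < la < d) ->
  exists2 w : 'rV[R]_n -> 'cV[R]_m, C_torus w & forall e d, 0 < e -> 0 < d ->
    exists2 la, S la /\ 0 < la < d &
      forall x i, `|u la x i ord0 - w x i ord0| <= e.
Proof.
move=> up ub uK Sacc.
have FP : ProperFilter (within S (0^'+)).
  apply: Build_ProperFilter_ex => A /right0_nearP[d d0 dA].
  by have [la laS /dA lad] := Sacc d d0; exists la; exact: lad.
have [G [GU sG]] := ultraFilterLemma FP.
have GS : G S by apply: sG; apply: nearW.
have G_lt d : 0 < d -> G [set la | 0 < la < d].
  by move=> d0; apply/sG/right0_nearP; exists d.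
have G1 : G [set la | 0 < la <= 1].
  by apply: filterS (G_lt 1 ltr01) => la /= /andP[-> /ltW].
have /choice[w wP] : forall x, exists w : 'cV[R]_m, forall i e, 0 < e ->
    G [set la | `|u la x i ord0 - w i ord0| <= e].
  move=> x; have /choice[w wP] : forall i : 'I_m, exists l, forall e, 0 < e ->
      G [set la | `|u la x i ord0 - l| <= e].
    move=> i; apply: (@ultra_bounded_limit _ _ (fun la => u la x i ord0) C) => //.
    by apply: filterS G1 => la la01; exact: ub.
  by exists (\col_i w i) => i e e0; rewrite mxE; exact: wP.
have wK i x y : w y i ord0 - w x i ord0 <= K * Num.sqrt (tdist2 (y - x)).
  apply/ler_addgt0Pr => e e0; have e2 : 0 < e / 2 by rewrite divr_gt0.
  have [la [[/= h1 h2] /= h3]] :=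
    filter_ex (filterI (filterI (wP x i _ e2) (wP y i _ e2)) G1).
  by have := uK la h3 i x y; move: h1 h2; rewrite !ler_norml; lra.
have wC : C_torus w.
  split=> [|z x].
    apply: continuous_mx => i j; rewrite (ord1 j).
    exact: gauge_lipschitz_continuous (wK i).
  apply/colP => i; apply/eqP; rewrite -subr_eq0 -normr_le0.
  apply/ler_addgt0Pr => e e0; have e2 : 0 < e / 2 by rewrite divr_gt0.
  have [la [[/= h1 h2] /= h3]] := filter_ex (filterI (filterI (wP x i _ e2)
    (wP (x + map_mx intr z) i _ e2)) G1).
  by move: h1 h2; rewrite (up la h3) !ler_norml; lra.
exists w => // e d e0 d0.
have unif : G [set la | cube `<=`
    [set x | forall i, `|u la x i ord0 - w x i ord0| <= e]].
  have e3 : 0 < e / 3 by rewrite divr_gt0.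
  have /compact_near_coveringP := @cube_compact R n.
  apply => x _ /=.
  have near_x := gauge_small x K e3.
  have near_la : G [set la | 0 < la <= 1 /\
      forall i, `|u la x i ord0 - w x i ord0| <= e / 3].
    by apply: filterI => //; apply: filter_forall => i; exact: wP.
  exists ([set y | K * Num.sqrt (tdist2 (y - x)) <= e / 3],
    [set la | 0 < la <= 1 /\ forall i, `|u la x i ord0 - w x i ord0| <= e / 3]).
    by split; [exact: near_x|exact: near_la].
  move=> [y la] [/= yx [la01 ula]] i.
  have := ula i; have := uK la la01 i x y; have := uK la la01 i y x.
  have := wK i x y; have := wK i y x.
  rewrite (tdist2C x y) !ler_norml; lra.
have [la [[laS lad] [la01 H]]] :=
  filter_ex (filterI (filterI GS (G_lt d d0)) (filterI G1 unif)).
exists la => // x i; have [z xc] := cube_repr x.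
have [_ pw] := wC.
by rewrite -(up la la01 z) -(pw z); exact: H.
Qed.

End Cluster.

(** * Stability of viscosity solutions *)

Section Stability.
Context {R : realType} {m n : nat}.
Variables (H : 'I_m -> 'rV[R]_n -> 'rV[R]_n -> R) (B : 'M[R]_m) (c : 'cV[R]_m).
Hypothesis (hH : convex_coercive H).

(** Adding [tdist2 (. - x0)] makes the maximum strict, so that a uniformly close [f] has
its maximum near [x0]; the gradient of the new test function is the old one at [x0]
and is continuous. *)
Lemma touching_stable (w psi : 'rV[R]_n -> R) (x0 : 'rV[R]_n) (eta : R) :
  C_torus w -> C1_torus psi ->
  (forall y, w y - psi y <= w x0 - psi x0) -> 0 < eta ->
  exists2 e, 0 < e & forall f, C_torus f -> (forall x, `|f x - w x| <= e) ->
    exists psi' x', [/\ C1_torus psi', forall y, f y - psi' y <= f x' - psi' x',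
      tdist2 (x' - x0) < eta & `|grad psi' x' - grad psi x0| < eta].
Proof.
move=> wC psiC1 max0 eta0.
pose psi' := psi \+ (fun y => tdist2 (y - x0)).
have psi'C1 : C1_torus psi' := C1_torusD psiC1 (C1_tdist2 x0).
have grad0 : grad psi' x0 = grad psi x0.
  rewrite /psi' gradD; [|by have [] := psiC1|by have [] := C1_tdist2 x0].
  by rewrite grad_tdist2 subrr dtdist20 addr0.
have [d d0 D] := torus_unif_cont (C1_torus_grad psi'C1) eta0.
have m0 : 0 < Num.min d eta by rewrite lt_min d0.
exists (Num.min d eta / 3) => [|f fC fw]; first by rewrite divr_gt0.
have [x' maxx'] : exists x', forall y, f y - psi' y <= f x' - psi' x'.
  have [cf pf] := fC; have [cpsi ppsi] := C1_torus_cont psi'C1.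
  apply: (@torus_max R n (fun v => f v - psi' v)); split=> [v|z v].
    exact: (continuousB (cf v) (cpsi v)).
  by rewrite pf ppsi.
have x'x0 : tdist2 (x' - x0) < Num.min d eta.
  have := maxx' x0; have := max0 x'; have := fw x'; have := fw x0.
  by rewrite /psi' /= subrr tdist20 !ler_norml; lra.
move: (x'x0); rewrite lt_min => /andP[x'd x'eta].
by exists psi', x'; split=> //; rewrite -grad0; exact: D.
Qed.

Lemma operator_close (w0 : 'cV[R]_m) (x0 p0 : 'rV[R]_n) k (eta : R) : 0 < eta ->
  exists2 d, 0 < d & forall la (U : 'cV[R]_m) x p, 0 < la < d ->
    (forall i, `|U i ord0 - w0 i ord0| <= d) -> tdist2 (x - x0) < d ->
    `|p - p0| <= d ->
    `|la * U k ord0 + (B *m U) k ord0 + H k x p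
      - (0 * w0 k ord0 + (B *m w0) k ord0 + H k x0 p0)| <= eta.
Proof.
move=> eta0; have eta2 : 0 < eta / 2 by rewrite divr_gt0.
have [d1 d10 D1] := ham_unif hH (enorm p0) eta2.
have [G G0 HG] := ham_lipschitz hH.
have be0 := entry_sum_ge0 B; set be := entry_sum B in be0.
have w0_ge0 := normr_ge0 (w0 k ord0).
pose T := `|w0 k ord0| + 1 + be + G.
have T0 : 0 < T by rewrite /T; lra.
pose d := Num.min 1 (Num.min d1 (eta / 2 / T)).
have d0 : 0 < d by rewrite !lt_min ltr01 d10 divr_gt0.
exists d => // la U x p /andP[la0 lad] Uw xx0 pp0.
have : d <= d by [].
rewrite {2}/d !le_min => /and3P[d_le1 d_le_d1 d_leT].
have dT : d * T <= eta / 2 by rewrite -ler_pdivlMr.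
have h1 : `|la * U k ord0| <= d * (`|w0 k ord0| + 1).
  rewrite normrM (gtr0_norm la0); apply: ler_pM => //; [exact: ltW|exact: ltW|].
  have := ler_normD (U k ord0 - w0 k ord0) (w0 k ord0); rewrite subrK.
  by have := Uw k; lra.
have h2 : `|(B *m U) k ord0 - (B *m w0) k ord0| <= be * d.
  have -> : (B *m U) k ord0 - (B *m w0) k ord0 = (B *m (U - w0)) k ord0.
    by rewrite mulmxBr; move: (B *m U) (B *m w0) => X Y; rewrite !mxE.
  by apply: mulmx_entry_le (ltW d0) _ => i; rewrite !mxE; exact: Uw.
have h3 : `|H k x p - H k x p0| <= G * d.
  by apply: le_trans (HG _ _ _ _) _; rewrite ler_wpM2l.
have h4 : `|H k x p0 - H k x0 p0| <= eta / 2.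
  by apply: D1 => //; exact: lt_le_trans xx0 d_le_d1.
move: dT h1 h2 h3 h4; rewrite /T mul0r !ler_norml; lra.
Qed.

Definition uniform_cluster (u : R -> 'rV[R]_n -> 'cV[R]_m)
    (w : 'rV[R]_n -> 'cV[R]_m) : Prop :=
  forall e d : R, 0 < e -> 0 < d -> exists2 la, 0 < la < d &
    forall x i, `|u la x i ord0 - w x i ord0| <= e.

(** The sign [s], equal to 1 or -1, covers subsolutions and supersolutions at once:
a minimum of [w - psi] is a maximum of [- w - (- psi)]. *)
Lemma touching_cluster u w (s : R) i psi x0 (eta : R) : s * s = 1 ->
  (forall la, 0 < la -> C_torus (u la)) -> C_torus w -> uniform_cluster u w ->
  C1_torus psi ->
  (forall y, s * (w y i ord0 - psi y) <= s * (w x0 i ord0 - psi x0)) ->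
  0 < eta -> exists la psi' x', [/\ 0 < la, C1_torus psi',
    (forall y, s * (u la y i ord0 - psi' y) <= s * (u la x' i ord0 - psi' x')) &
    `|la * u la x' i ord0 + (B *m u la x') i ord0 + H i x' (grad psi' x')
      - (0 * w x0 i ord0 + (B *m w x0) i ord0 + H i x0 (grad psi x0))| <= eta].
Proof.
move=> ss uC wC cl psiC1 max0 eta0.
have s1 : `|s| = 1.
  by apply/eqP; rewrite -(@eqrXn2 _ 2)// expr1n -normrX expr2 ss normr1.
have [d d0 D] := operator_close (w x0) x0 (grad psi x0) i eta0.
have d2 : 0 < d / 2 by rewrite divr_gt0.
have [d1 d10 D1] := torus_unif_cont wC d2.
have m0 : 0 < Num.min d d1 by rewrite lt_min d0.
have [|e e0 E] := touching_stable (C_torusZ s (C_torus_coord i wC))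
  (C1_torusZ s psiC1) (x0 := x0) _ m0.
  by move=> y; rewrite -!mulrBr.
have e'0 : 0 < Num.min e (d / 2) by rewrite lt_min e0.
have [la /andP[la0 lad] uw] := cl _ _ e'0 d0.
have [|psi'' [x' [psi''C1 max' x'x0 g]]] :=
  E _ (C_torusZ s (C_torus_coord i (uC la la0))).
  move=> x; rewrite -mulrBr normrM s1 mul1r.
  by apply: le_trans (uw x i) _; rewrite ge_min lexx.
exists la, (fun y => s * psi'' y), x'; split.
- exact: la0.
- exact: (C1_torusZ s psi''C1).
- by move=> y; rewrite !mulrBr !mulrA ss !mul1r.
move: x'x0 g; rewrite !lt_min => /andP[x'd x'd1] /andP[gd _].
have [_ dpsi'' _] := psi''C1; have [_ dpsi _] := psiC1.
apply: D; [by rewrite la0| |exact: x'd|].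
  move=> j; have : `|u la x' j ord0 - w x' j ord0| <= d / 2.
    by apply: le_trans (uw x' j) _; rewrite ge_min lexx orbT.
  have := le_lt_trans (coord_le_norm _ j ord0) (D1 _ _ x'd1).
  by rewrite !mxE; rewrite ltr_norml !ler_norml; lra.
rewrite (gradZ s (dpsi'' x')); rewrite (gradZ s (dpsi x0)) in gd.
have -> : s *: grad psi'' x' - grad psi x0 =
    s *: (grad psi'' x' - s *: grad psi x0).
  by rewrite scalerBr scalerA ss scale1r.
by rewrite normrZ s1 mul1r ltW.
Qed.

Lemma ergodic_of_cluster u w :
  (forall la, 0 < la -> viscosity_solution la B H c (u la)) ->
  C_torus w -> uniform_cluster u w -> ergodic_solution B H c w.
Proof.
move=> usol wC cl.
have uC la : 0 < la -> C_torus (u la) by move=> /usol [[]].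
split; split=> // i psi x0 psiC1 max0.
  apply/ler_addgt0Pr => eta eta0.
  have [|y|la [psi' [x' [la0 C1' max' close]]]] :=
    touching_cluster (s := 1) _ uC wC cl psiC1 (i := i) (x0 := x0) _ eta0.
  - by rewrite mulr1.
  - by rewrite !mul1r.
  have [[_ sub] _] := usol la la0.
  have := sub i psi' x' C1'; move: close; rewrite ler_norml => /andP[close _].
  have max1 y : u la y i ord0 - psi' y <= u la x' i ord0 - psi' x'.
    by have := max' y; rewrite !mul1r.
  by move=> /(_ max1); lra.
apply/ler_addgt0Pr => eta eta0.
have [|y|la [psi' [x' [la0 C1' max' close]]]] :=
  touching_cluster (s := -1) _ uC wC cl psiC1 (i := i) (x0 := x0) _ eta0.
- by rewrite mulrNN mulr1.
- by rewrite !mulN1r lerN2.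
have [_ [_ super]] := usol la la0.
have := super i psi' x' C1'; move: close; rewrite ler_norml => /andP[_ close].
have maxN y : u la x' i ord0 - psi' x' <= u la y i ord0 - psi' y.
  by have := max' y; rewrite !mulN1r lerN2.
by move=> /(_ maxN); lra.
Qed.

End Stability.

(** * The vanishing discount limit *)

Section VanishingDiscount.
Context {R : realType} {m n : nat}.
Variables (H : 'I_m -> 'rV[R]_n -> 'rV[R]_n -> R) (B : 'M[R]_m).

Lemma C_torus_shift (u : 'rV[R]_n -> 'cV[R]_m) (d : 'cV[R]_m) :
  C_torus u -> C_torus (fun x => u x + d).
Proof.
move=> [cu pu]; split=> [x|z x]; last by rewrite pu.
by apply: (continuousD (cu x)); exact: cst_continuous.
Qed.

Lemma shift_operator la la' (U d : 'cV[R]_m) k (h : R) :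
  la' * (U + d) k ord0 + (B *m (U + d)) k ord0 + h =
  la * U k ord0 + (B *m U) k ord0 + h +
  (la' * (U + d) k ord0 - la * U k ord0 + (B *m d) k ord0).
Proof.
rewrite mulmxDr; move: (B *m U) (B *m d) => X Y.
by rewrite !mxE; ring.
Qed.

(** Adding a constant vector leaves gradients unchanged, so that only the zeroth order
terms move. *)
Lemma subsolution_shift la la' (c c' d : 'cV[R]_m) u :
  (forall x k, la' * (u x + d) k ord0 - la * u x k ord0 + (B *m d) k ord0
     <= c' k ord0 - c k ord0) ->
  viscosity_subsolution la B H c u ->
  viscosity_subsolution la' B H c' (fun x => u x + d).
Proof.
move=> hd [uC sub]; split=> [|k psi x psiC1 maxx]; first exact: C_torus_shift.
rewrite (shift_operator la); have := hd x k.
have : forall y, u y k ord0 - psi y <= u x k ord0 - psi x.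
  by move=> y; have := maxx y; rewrite !mxE; lra.
by move/(sub k psi x psiC1); lra.
Qed.

Lemma supersolution_shift la la' (c c' d : 'cV[R]_m) u :
  (forall x k, c' k ord0 - c k ord0 <=
     la' * (u x + d) k ord0 - la * u x k ord0 + (B *m d) k ord0) ->
  viscosity_supersolution la B H c u ->
  viscosity_supersolution la' B H c' (fun x => u x + d).
Proof.
move=> hd [uC sup]; split=> [|k psi x psiC1 minx]; first exact: C_torus_shift.
rewrite (shift_operator la); have := hd x k.
have : forall y, u x k ord0 - psi x <= u y k ord0 - psi y.
  by move=> y; have := minx y; rewrite !mxE; lra.
by move/(sup k psi x psiC1); lra.
Qed.

Hypotheses (hH : convex_coercive H) (hB : monotone_mx B).
Variable (c : 'cV[R]_m).

Lemma monotone_mx_const (C : R) k :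
  0 <= C -> 0 <= (B *m (const_mx C : 'cV[R]_m)) k ord0.
Proof. by move=> C0; apply: hB => [i|]; rewrite !mxE. Qed.

(** Constants [C] with [`|v0| <= C] turn the ergodic solution into a supersolution
[v0 + C] and a subsolution [v0 - C] of every discounted problem, because
[v0 + C >= 0 >= v0 - C] and a monotone [B] maps nonnegative constants to
nonnegative vectors. *)
Lemma discounted_bound v0 u (la C : R) : 0 < la ->
  ergodic_solution B H c v0 -> (forall x i, `|v0 x i ord0| <= C) ->
  viscosity_solution la B H c u -> forall x i, `|u x i ord0| <= 2 * C.
Proof.
move=> la0 [sub0 sup0] v0C [subu supu] x i.
have C0 : 0 <= C by apply: le_trans (v0C x i).
have up : viscosity_supersolution la B H c (fun x => v0 x + const_mx C).
  apply: supersolution_shift sup0 => y k; rewrite subrr mul0r subr0.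
  apply: addr_ge0; last exact: monotone_mx_const.
  rewrite mulr_ge0 ?(ltW la0)// !mxE.
  by have := v0C y k; rewrite ler_norml; lra.
have down : viscosity_subsolution la B H c (fun x => v0 x - const_mx C).
  apply: subsolution_shift sub0 => y k; rewrite subrr mul0r subr0.
  have -> : (B *m - (const_mx C : 'cV[R]_m)) k ord0 =
      - (B *m (const_mx C : 'cV[R]_m)) k ord0.
    by rewrite mulmxN; move: (B *m _) => X; rewrite mxE.
  rewrite subr_le0; apply: (@le_trans _ _ 0); last exact: monotone_mx_const.
  rewrite mulr_ge0_le0 ?(ltW la0)// !mxE.
  by have := v0C y k; rewrite ler_norml; lra.
have := comparison hH hB la0 subu up i x.
have := comparison hH hB la0 down supu i x.
by have := v0C x i; rewrite !mxE !ler_norml; lra.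
Qed.

Lemma discounted_equilipschitz v0 : ergodic_solution B H c v0 ->
  exists C K : R, forall la u, 0 < la <= 1 -> viscosity_solution la B H c u ->
    (forall x i, `|u x i ord0| <= C) /\
    (forall i x y, u y i ord0 - u x i ord0 <= K * Num.sqrt (tdist2 (y - x))).
Proof.
move=> v0sol; have [C C0 v0C] := torus_bounded v0sol.1.1.
have [r Hr] := ham_sublevel hH (`|c| + (1 + entry_sum B) * (2 * C)).
exists (2 * C), (`|r| + 8 * (2 * C) + 1) => la u /andP[la0 la1] usol.
have ub := discounted_bound la0 v0sol v0C usol.
split=> // i; have [[uC sub] _] := usol.
apply: subgradient_bound_lipschitz => [|x|psi x psiC1 maxx].
- exact: C_torus_coord.
- exact: ub.
apply: (Hr i x); have := sub i psi x psiC1 maxx.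
have C20 : 0 <= 2 * C by rewrite mulr_ge0.
have := mulmx_entry_le B i C20 (ub x).
have := le_trans (ler_norm _) (coord_le_norm c i ord0).
have : `|la * u x i ord0| <= 1 * (2 * C).
  by rewrite normrM ler_pM// gtr0_norm.
by rewrite !ler_norml; lra.
Qed.

(** The gap between [w] and [u la] is small for some [la], and by
[critical_gap_monotone] it stays small for all smaller ones. *)
Lemma cluster_is_lower_limit (u : R -> 'rV[R]_n -> 'cV[R]_m) w :
  (forall la, 0 < la -> viscosity_solution la B H c (u la)) ->
  ergodic_solution B H c w -> uniform_cluster u w ->
  forall e, 0 < e -> exists2 d, 0 < d &
    forall la, 0 < la < d -> forall x i, w x i ord0 - u la x i ord0 <= e.
Proof.
move=> usol [subw _] cl e e0.
have [la0 /andP[la0_gt0 _] la0P] := cl _ _ e0 ltr01.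
exists la0 => // la /andP[la_gt0 lala0] x i.
have [subu _] := usol _ la0_gt0; have [_ supu] := usol _ la_gt0.
apply: (critical_gap_monotone hH hB la_gt0 lala0 (ltW e0) subw subu supu).
by move=> j y; have := la0P y j; rewrite ler_norml; lra.
Qed.

Lemma cluster_unique (u : R -> 'rV[R]_n -> 'cV[R]_m) w1 w2 :
  (forall la, 0 < la -> viscosity_solution la B H c (u la)) ->
  ergodic_solution B H c w1 -> uniform_cluster u w1 -> uniform_cluster u w2 ->
  forall x i, w1 x i ord0 <= w2 x i ord0.
Proof.
move=> usol w1sol cl1 cl2 x i; apply/ler_addgt0Pr => e e0.
have e2 : 0 < e / 2 by rewrite divr_gt0.
have [d d0 D] := cluster_is_lower_limit usol w1sol cl1 e2.
have [la lad close] := cl2 _ _ e2 d0.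
by have := D la lad x i; have := close x i; rewrite ler_norml; lra.
Qed.

(** If [u la] did not converge to the cluster point [w], the parameters at which it is
far from [w] would produce a second cluster point, against [cluster_unique]. *)
Lemma vanishing_discount v0 (u : R -> 'rV[R]_n -> 'cV[R]_m) :
  ergodic_solution B H c v0 ->
  (forall la, 0 < la -> viscosity_solution la B H c (u la)) ->
  exists w, [/\ C_torus w, ergodic_solution B H c w &
    forall e, 0 < e -> exists2 d, 0 < d & forall la, 0 < la < d ->
      forall x i, `|u la x i ord0 - w x i ord0| <= e].
Proof.
move=> v0sol usol.
have [C [K CK]] := discounted_equilipschitz v0sol.
have gt0 (la : R) : 0 < la <= 1 -> 0 < la by case/andP.
have cluster (S : set R) : (forall d, 0 < d -> exists2 la, S la & 0 < la < d) ->
    exists w, [/\ C_torus w, ergodic_solution B H c w, uniform_cluster u w &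
      forall e d, 0 < e -> 0 < d -> exists2 la, S la /\ 0 < la < d &
        forall x i, `|u la x i ord0 - w x i ord0| <= e].
  move=> Sacc.
  have [la la01|la la01|la la01|w wC wS] :=
    equilipschitz_cluster (u := u) (C := C) (K := K) _ _ _ Sacc.
  - by have [[[_ pu] _] _] := usol la (gt0 la la01).
  - by have [] := CK la _ la01 (usol la (gt0 la la01)).
  - by have [] := CK la _ la01 (usol la (gt0 la la01)).
  have cl : uniform_cluster u w.
    by move=> e d e0 d0; have [la [_ lad] close] := wS e d e0 d0; exists la.
  by exists w; split=> //; exact: ergodic_of_cluster usol wC cl.
have [|w [wC wsol wcl _]] := cluster setT.
  move=> d d0; exists (d / 2) => //.
  by rewrite divr_gt0//= ltr_pdivrMr// ltr_pMr// ltr1n.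
exists w; split=> // e e0; apply: contrapT => nd.
pose S := [set la | exists x i, e < `|u la x i ord0 - w x i ord0|].
have [|w' [_ w'sol w'cl w'S]] := cluster S.
  move=> d d0; apply: contrapT => noS; apply: nd; exists d => // la lad x i.
  by rewrite leNgt; apply/negP => far; apply: noS; exists la => //; exists x, i.
have [la [[x [i far]] _] close] := w'S e 1 e0 ltr01.
have := close x i; rewrite leNgt.
have -> : w' x i ord0 = w x i ord0.
  by apply/eqP; rewrite eq_le !(cluster_unique usol).
by rewrite far.
Qed.

End VanishingDiscount.

Theorem theorem19 (R : realType) (m n : nat) (m_gt0 : (0 < m)%N)
    (n_gt0 : (0 < n)%N) (Xi : metricType R)
    (Xi_neq0 : [set: Xi] !=set0) (Xi_compact : compact [set: Xi])
    (g : 'I_m -> 'rV[R]_n * Xi -> 'rV[R]_n) (L : 'I_m -> 'rV[R]_n * Xi -> R)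
    (g_cont : forall i, C_torus_prod (g i))
    (L_cont : forall i, C_torus_prod (L i))
    (H_coercive : coercive (hamiltonian g L))
    (B : 'M[R]_m) (B_monotone : monotone_mx B)
    (c : 'cV[R]_m) (v0 : 'rV[R]_n -> 'cV[R]_m)
    (v0_sol : ergodic_solution B (hamiltonian g L) c v0)
    (v : R -> 'rV[R]_n -> 'cV[R]_m)
    (v_sol : forall la : R, 0 < la ->
       viscosity_solution la B (hamiltonian g L) 0 (v la)) :
  exists w : 'rV[R]_n -> 'cV[R]_m,
    [/\ C_torus w,
        {uniform, (fun (la : R) (x : 'rV[R]_n) =>
                     v la x + invmx (la%:M + B) *m c) @ 0^'+ --> w}
      & ergodic_solution B (hamiltonian g L) c w].
Proof.
have hH := hamiltonian_convex_coercive
  Xi_neq0 Xi_compact g_cont L_cont H_coercive.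
pose u la x := v la x + invmx (la%:M + B) *m c.
have u_sol la : 0 < la -> viscosity_solution la B (hamiltonian g L) c (u la).
  move=> la0; have [sub super] := v_sol la la0.
  have shiftE x k : la * u la x k ord0 - la * v la x k ord0
      + (B *m (invmx (la%:M + B) *m c)) k ord0 = c k ord0 - (0 : 'cV[R]_m) k ord0.
    have cE : c = la *: (invmx (la%:M + B) *m c) + B *m (invmx (la%:M + B) *m c).
      by rewrite -mul_scalar_mx -mulmxDl mulKVmx// monotone_mx_unit.
    rewrite {2}cE /u; move: (invmx _ *m c) => d; move: (B *m d) => Y.
    by rewrite !mxE; ring.
  by split; [apply: subsolution_shift sub|apply: supersolution_shift super]
     => x k; rewrite shiftE.
have [w [wC w_sol w_lim]] := vanishing_discount hH B_monotone v0_sol u_sol.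
exists w; split=> // P /uniform_nbhs[E [entE EP]].
have [e /= e0 eE] : exists2 e : R, 0 < e &
    forall U V : 'cV[R]_m, `|U - V| < e -> E (U, V).
  by move: entE; rewrite -entourage_ballE => -[e e0 eE]; exists e => // U V UV;
     apply: eE; rewrite /= -ball_normE.
have e2 : 0 < e / 2 by rewrite divr_gt0.
have [d d0 D] := w_lim _ e2.
apply/right0_nearP; exists d => // la lad; apply: EP => x _; apply: eE.
apply: (@le_lt_trans _ _ (e / 2)); last by lra.
apply: norm_leP => [|i j]; first exact: ltW.
by rewrite (ord1 j) !mxE distrC; have := D la lad x i; rewrite !mxE.
Qed.
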